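(* Let $P$ be the transition kernel of a $\pi$-irreducible Markov chain that is reversible with respect to its invariant probability measure $\pi$ and non-negative definite. Assume that there exist an accessible atom $A$ and a constant $\kappa>1$ such that $$L:=\sup_{x\in A}\mathbb{E}_x[\kappa^{\tau_A}]<\infty .$$ Then $r_0(P)\le\kappa^{-1}$. Moreover (for all $n$), $$\sup_{x\in A}\|P^n(x,\cdot)-\pi\|_{\mathrm{Var}}\le\bigl(\pi(A)^{-1}-1\bigr)^{1/2}\kappa^{-n},$$ and for $\pi$-a.s. $x\in X$ there exists a constant $C(x)<\infty$ such that $$\|P^n(x,\cdot)-\pi\|_{\mathrm{Var}}\le C(x)\kappa^{-n}.$$
   Context: $\Phi=\{\Phi_n:n\in\mathbb{Z}_+\}$ is a discrete-time homogeneous Markov chain on a general state space $X$ with countably generated $\sigma$-field $\mathscr{B}(X)$ and $n$-step transition kernel $P^n(x,B)=\mathbb{P}_x\{\Phi_n\in B\}$; $\mathbb{P}_x,\mathbb{E}_x$ are probability and expectation given $\Phi_0=x$. The chain has a (unique) invariant probability measure $\pi$ and is $\pi$-irreducible: if $\pi(B)>0$, there exists $n\in\mathbb{N}$ such that $P^n(x,B)>0$ for all $x\in X$. It is assumed that $P^n(x,\cdot)\ll\pi$ ($n\ge1$), with density $p^n(x,y)$. Reversible: $\pi(dx)P(x,dy)=\pi(dy)P(y,dx)$. Non-negative definite: $\int_X f(x)Pf(x)\,\pi(dx)\ge0$ for all $f\in L^2(\pi,X)$, where $Pf(x)=\int f(y)P(x,dy)$. A set $A\in\mathscr{B}(X)$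 is an atom if there is a probability measure $\nu$ on $\mathscr{B}(X)$ with $P(x,B)=\nu(B)$ for all $x\in A$, $B\in\mathscr{B}(X)$; it is an accessible atom if moreover $\pi(A)>0$. $\tau_A=\inf\{n\ge1:\Phi_n\in A\}$. $r_0(P)$ is the spectral radius of $P$ on the Hilbert space $\mathbb{H}=\{f\in L^2(\pi,X):\pi(f)=0\}$. $\|\mu\|_{\mathrm{Var}}=\sup_{|f|\le1}|\mu(f)|$ for a signed measure $\mu$.
   Formalization: The second bound (sup over x in A) is stated for n ≥ 1 only, since at n = 0 it fails: for P(x,·) = π uniform on two points and A = X, the right side is 0 while the variation distance of δ_x from π is 1. *)

(* Defs.v *)
From HB Require Import structures.
From mathcomp Require Import all_boot all_order all_algebra.
From mathcomp Require Import complex.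
From mathcomp Require Import all_classical all_reals all_analysis.
Import Order.TTheory GRing.Theory Num.Theory.
Import numFieldNormedType.Exports.

Set Implicit Arguments.
Unset Strict Implicit.
Unset Printing Implicit Defensive.

Local Open Scope classical_set_scope.
Local Open Scope ring_scope.

Definition countably_generated d (X : measurableType d) : Prop :=
  exists G : nat -> set X, @measurable d X = <<s range G >>.

Section kernels.
Context {d : measure_display} {X : measurableType d} {R : realType}.
Implicit Types (P : R.-pker X ~> X) (pi : probability X R).

(* n-fold composition of P; for a Markov chain Phi with kernel P this is the
   law of Phi_n started at x. *)
Fixpoint kiter P (n : nat) : R.-spker X ~> X :=
  if n is m.+1 then mkcomp_noparam (kiter P m) P
  else kdirac (@measurable_id _ X setT).

Definition invariant_probability pi P : Prop :=
  forall B, measurable B -> (\int[pi]_x P x B = pi B)%E.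

(* The hitting step n may depend on both x and B. *)
Definition irreducible pi P : Prop :=
  forall B, measurable B -> (0 < pi B)%E ->
  forall x, exists2 n, (0 < n)%N & (0 < kiter P n x B)%E.

Definition abs_continuous pi P : Prop :=
  forall n x, (0 < n)%N -> kiter P n x `<< pi.

(* Equality, on every measurable subset of X * X, of the two measures
   pi(dx) P(x, dy) and pi(dy) P(y, dx). *)
Definition reversible pi P : Prop :=
  forall C : set (X * X), measurable C ->
  (\int[pi]_x P x (xsection C x) = \int[pi]_y P y (ysection C y))%E.

(* For f in L^2(pi), the integral is finite for pi-almost every x; at the
   other points the value is junk. *)
Definition kop P (f : X -> R) (x : X) : R := \int[P x]_y f y.

Definition nonneg_definite pi P : Prop :=
  forall f : X -> R, f \in Lfun pi 2%:E -> 0 <= \int[pi]_x (f x * kop P f x).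

Definition atom P (A : set X) : Prop :=
  measurable A /\ exists nu : probability X R,
    forall x B, A x -> measurable B -> P x B = nu B.

Definition accessible_atom pi P (A : set X) : Prop :=
  atom P A /\ (0 < pi A)%E.

(* The norm of the signed measure mu - nu, as the supremum of
   |mu(f) - nu(f)| over measurable f with |f| <= 1. *)
Definition var_dist (mu nu : {measure set X -> \bar R}) : \bar R :=
  ereal_sup [set `| \int[mu]_x f x - \int[nu]_x f x |%:E
            | f in [set f : X -> R | measurable_fun setT f /\
                                     forall x, `|f x| <= 1]].

End kernels.

Section markov_chains.
Context {d : measure_display} {X : measurableType d} {R : realType}.
Context {d' : measure_display} {Omega : measurableType d'}.
Implicit Types (P : R.-pker X ~> X) (Phi : nat -> {mfun Omega >-> X})
  (Pr : X -> probability Omega R).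

Definition natural_filtration Phi (n : nat) : set (set Omega) :=
  <<s \bigcup_(k in [set k | (k <= n)%N])
        preimage_set_system setT (Phi k) measurable >>.

(* Singletons of X need not be measurable, so that "Phi_0 = x" is expressed
   by the law of Phi_0 under Pr x.  The second clause says that P (Phi_n, B)
   is a version of the conditional probability of Phi_(n+1) \in B given
   Phi_0, ..., Phi_n. *)
Definition markov_chain P Phi Pr : Prop :=
  (forall x B, measurable B -> (Pr x (Phi 0%N @^-1` B) = \d_x B)%E) /\
  (forall x n E B, natural_filtration Phi n E -> measurable B ->
     (Pr x (E `&` Phi n.+1 @^-1` B) = \int[Pr x]_(w in E) P (Phi n w) B)%E).

(* +oo when A is never visited at a time n >= 1 *)
Definition return_time Phi (A : set X) (w : Omega) : \bar R :=
  ereal_inf [set n%:R%:E | n in [set n | (0 < n)%N /\ A (Phi n w)]].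

End markov_chains.

(* kappa ^ t for kappa > 1, with the corresponding values at infinite t *)
Definition powRe {R : realType} (kappa : R) (t : \bar R) : \bar R :=
  match t with
  | r%:E => (kappa `^ r)%:E
  | +oo%E => +oo%E
  | -oo%E => 0%E
  end.

(* Since L^2(pi) is a real Hilbert space, spectra are taken in its
   complexification, on which P acts componentwise.  Elements of Hilbert
   spaces are represented by functions, equal when they agree
   pi-almost everywhere. *)
Section spectrum.
Context {d : measure_display} {X : measurableType d} {R : realType}.
Implicit Types (P : R.-pker X ~> X) (pi : probability X R).

Definition L2_0 pi (f : X -> R) : Prop :=
  f \in Lfun pi 2%:E /\ \int[pi]_x f x = 0.

Definition L2_0C pi (f : X -> R[i]) : Prop :=
  L2_0 pi (fun x => complex.Re (f x)) /\
  L2_0 pi (fun x => complex.Im (f x)).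

Definition L2normC pi (f : X -> R[i]) : \bar R :=
  Lnorm pi 2%:E (fun x => (Normc.normc (f x))%:E).

Definition kopC P (f : X -> R[i]) (x : X) : R[i] :=
  Complex (kop P (fun y => complex.Re (f y)) x)
          (kop P (fun y => complex.Im (f y)) x).

(* lam - P is a bijection of the complexified space with bounded inverse *)
Definition resolvent_set pi P : set R[i] :=
  [set lam | exists M : R, forall h, L2_0C pi h -> exists f,
    [/\ L2_0C pi f,
        {ae pi, forall x, lam * f x - kopC P f x = h x},
        (L2normC pi f <= M%:E * L2normC pi h)%E &
        forall g, L2_0C pi g ->
          {ae pi, forall x, lam * g x - kopC P g x = h x} ->
          {ae pi, forall x, g x = f x}]].

Definition spectrum pi P : set R[i] := ~` resolvent_set pi P.

(* The spectrum is empty, and the supremum -oo, only when L2_0C is trivial. *)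
Definition r0 pi P : \bar R :=
  ereal_sup [set (Normc.normc lam)%:E | lam in spectrum pi P].

End spectrum.

(* Main.v *)
(* Write [q = kappa^-1].  The function [W x = E_x (kappa ^ sigma)], [sigma] the
   hitting time of [A], satisfies [P W = q W] off [A], and is finite almost
   everywhere by irreducibility.  By reversibility and AM-GM this bounds the
   quadratic form [<P g, g>] by [q <g, g>] for [g] vanishing on [A].  As [A] is
   an atom, [P f] does not change when [f] is replaced on [A] by its average,
   so that functions vanishing on [A] have codimension one for the purposes of
   [P]; as in Cauchy interlacing, [<P f, f> <= q <f, f>] follows for all
   centered [f], since the constants carry the eigenvalue 1.  With
   non-negativity this gives [||P f|| <= q ||f||] on centered functions, hence
   the bound on the spectrum by a Neumann series.  For [x] in the atom, [P^n f x] is an inner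
   product of [P^n f] with [1_A / pi A - 1], whose norm is the stated constant;
   the bound at other points follows by induction on [n] from the drift
   inequality for [W]. *)

Require Import Defs.
From mathcomp Require Import all_boot all_order all_algebra.
From mathcomp Require Import complex finmap.
From mathcomp Require Import all_classical all_reals all_analysis.
From mathcomp Require Import measurable_realfun.
From mathcomp Require Import ring lra.
Import Order.TTheory GRing.Theory Num.Theory.
Import numFieldNormedType.Exports.

Set Implicit Arguments.
Unset Strict Implicit.
Unset Printing Implicit Defensive.

Local Open Scope classical_set_scope.
Local Open Scope ring_scope.

(** * Functional induction and reversibility *)

(** The AM-GM bound is Schur's test for the killed kernel with weight [W]. Passing back from
    functions vanishing on [A] to centered functions keeps only the upper bound on [<P f, f>]: one
    very negative eigenvalue could survive, and this is what non-negativity excludes. It is applied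
    to the single vector [f - q^-1 P f], so no spectral theorem or square root of [P] is invoked.

    Two conventions shape the details. [kop] is a real integral with a default value where [f] is
    not integrable for [P x]; linearity and the resolvent equations therefore hold only almost
    everywhere, and identities between double integrals are proved for nonnegative extended-real
    integrands. Measurability of [return_time] is never established: its exponential moment is
    bounded from below by integrals of measurable functions, which equal truncated moments built
    from [P] alone. Complex functions are treated as pairs of real ones, multiplication by a scalar
    becoming a 2 by 2 real combination. *)

Lemma ge0_le_lower_integral d (T : measurableType d) (R : realType)
    (mu : {measure set T -> \bar R}) (f g : T -> \bar R) :
  (forall x, 0 <= f x)%E -> (forall x, f x <= g x)%E ->
  (\int[mu]_x f x <= \int[mu]_x g x)%E.
Proof.
move=> f0 fg; have g0 x : (0 <= g x)%E by exact: le_trans (f0 x) (fg x).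
(* Both integrals are suprema over simple functions below the integrand, so monotonicity requires no
   measurability. *)
rewrite !ge0_integralTE//; apply: le_ereal_sup => _ [h hf <-].
by exists h => // x; exact: le_trans (hf x) (fg x).
Qed.

Section measurable_induction.
Context d (T : measurableType d) (R : realType).
Variable H : (T -> \bar R) -> Prop.
Import HBNNSimple.

(** The functional form of the monotone class argument, through simple approximations. The closure
    conditions carry measurability and sign so that users can apply additivity and monotone
    convergence of integrals. *)
Lemma ge0_measurable_ind :
  (forall B, measurable B -> H (fun x => (\1_B x)%:E)) ->
  (forall f g : T -> \bar R, measurable_fun setT f -> measurable_fun setT g ->
    (forall x, 0 <= f x)%E -> (forall x, 0 <= g x)%E ->
    H f -> H g -> H (fun x => f x + g x)%E) ->
  (forall (k : R) (f : T -> \bar R), 0 <= k -> measurable_fun setT f ->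
    (forall x, 0 <= f x)%E ->
    H f -> H (fun x => k%:E * f x)%E) ->
  (forall f_ : (T -> \bar R)^nat, (forall n, measurable_fun setT (f_ n)) ->
    (forall n x, 0 <= f_ n x)%E -> (forall x, nondecreasing_seq (f_ ^~ x)) ->
    (forall n, H (f_ n)) -> H (fun x => limn (f_ ^~ x))) ->
  forall f : T -> \bar R, measurable_fun setT f -> (forall x, 0 <= f x)%E ->
    H f.
Proof.
move=> H1 HD HZ Hlim f mf f0.
pose g := nnsfun_approx measurableT mf.
have -> : f = fun x => limn (fun n => (g n x)%:E).
  apply/funext => x; apply/esym/cvg_lim => //.
  exact: cvg_nnsfun_approx.
apply: Hlim => [n|n x|x m n mn|n].
- exact/measurable_EFinP.
- by rewrite lee_fin.
- by rewrite lee_fin; exact/lefP/nd_nnsfun_approx.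
pose F r x := (r * \1_(g n @^-1` [set r]) x)%R.
have -> : (fun x => (g n x)%:E) =
    (fun x => \sum_(r <- fset_set (range (g n))) (F r x)%:E)%E.
  by apply/funext => x; rewrite fimfunE fsbig_finite//= sumEFin.
(* The values taken are nonnegative, so only nonnegative multiples of indicators occur; the finite
   sum is then unrolled over the list of values. *)
have : forall r, r \in (fset_set (range (g n)) : seq R) -> 0 <= r.
  by move=> r; rewrite in_fset_set// => /set_mem[x _ <-].
elim: (fset_set (range (g n)) : seq R) => [_|r s ih rs].
  under eq_fun do rewrite big_nil.
  have -> : (fun=> 0%E) = (fun x : T => (\1_set0 x)%:E) :> (T -> \bar R).
    by apply/funext => x; rewrite indic0.
  exact: H1.
under eq_fun do rewrite big_cons.
have F0 u x : 0 <= u -> (0 <= (F u x)%:E)%E by move=> u0;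
  rewrite lee_fin mulr_ge0.
have mF u : measurable_fun setT (fun x => (F u x)%:E).
  apply/measurable_EFinP; apply: measurable_funM => //.
have rs' u : u \in s -> 0 <= u by move=> us; apply: rs; rewrite inE us orbT.
apply: HD => //.
- exact: emeasurable_sum.
- by move=> x; apply: F0; apply: rs; rewrite inE eqxx.
- by move=> x; rewrite big_seq sume_ge0// => u /rs' u0; exact: F0.
- rewrite (_ : (fun _ => _) = fun x => (r%:E * (\1_(g n @^-1` [set r]) x)%:E)%E)
  //.
  apply: HZ; [by apply: rs; rewrite inE eqxx| | |exact: H1].
    exact/measurable_EFinP.
  by move=> x; rewrite lee_fin.
exact: ih.
Qed.

End measurable_induction.

Section kernel_integrals.
Context {d} {X : measurableType d} {R : realType}.
Variables (P : R.-pker X ~> X) (pi : probability X R).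

Lemma measurable_int_kernel2 (G : X * X -> \bar R) :
  measurable_fun setT G -> (forall z, 0 <= G z)%E ->
  measurable_fun setT (fun x => \int[P x]_y G (x, y))%E.
Proof. by move=> mG G0; exact: measurable_fun_integral_finite_kernel. Qed.

Lemma measurable_int_kernel (g : X -> \bar R) :
  measurable_fun setT g -> (forall z, 0 <= g z)%E ->
  measurable_fun setT (fun x => \int[P x]_y g y)%E.
Proof.
move=> mg g0; apply: measurable_fun_integral_kernel => // U mU.
exact: measurable_kernel.
Qed.

(** Both sides are additive, homogeneous and continuous along increasing sequences as functionals of
    [G], and [reversible] is their equality on indicators. *)
Lemma reversible_integral (G : X * X -> \bar R) :
  reversible pi P -> measurable_fun setT G -> (forall z, 0 <= G z)%E ->
  (\int[pi]_x \int[P x]_y G (x, y) = \int[pi]_x \int[P x]_y G (y, x))%E.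
Proof.
move=> rev mG G0.
pose sw (z : X * X) := (z.2, z.1).
have msw : measurable_fun setT sw by exact: measurable_swap.
pose I (F : X * X -> \bar R) := (\int[pi]_x \int[P x]_y F (x, y))%E.
have mx (F : X * X -> \bar R) x : measurable_fun setT F ->
    measurable_fun setT (fun y => F (x, y)).
  by move=> mF; exact: measurableT_comp mF (measurable_pair1 x).
have ID F1 F2 : measurable_fun setT F1 -> measurable_fun setT F2 ->
    (forall x, 0 <= F1 x)%E -> (forall x, 0 <= F2 x)%E ->
    I (fun z => F1 z + F2 z)%E = (I F1 + I F2)%E.
  move=> m1 m2 p1 p2; rewrite /I -ge0_integralD//; last 4 first.
  - by move=> x _; exact: integral_ge0.
  - exact: measurable_int_kernel2.
  - by move=> x _; exact: integral_ge0.
  - exact: measurable_int_kernel2.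
  by apply: eq_integral => x _; rewrite ge0_integralD//; exact: mx.
have IZ k F1 : 0 <= k -> measurable_fun setT F1 -> (forall x, 0 <= F1 x)%E ->
    I (fun z => k%:E * F1 z)%E = (k%:E * I F1)%E.
  move=> k0 m1 p1; rewrite /I -ge0_integralZl_EFin//; last 2 first.
  - by move=> x _; exact: integral_ge0.
  - exact: measurable_int_kernel2.
  by apply: eq_integral => x _; rewrite ge0_integralZl_EFin//; exact: mx.
have Il (f_ : (X * X -> \bar R)^nat) : (forall n, measurable_fun setT (f_ n)) ->
    (forall n x, 0 <= f_ n x)%E -> (forall x, nondecreasing_seq (f_ ^~ x)) ->
    I (fun z => limn (f_ ^~ z)) = limn (fun n => I (f_ n)).
  move=> m1 p1 nd1; rewrite /I -monotone_convergence//; last 3 first.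
  - by move=> n; exact: measurable_int_kernel2.
  - by move=> n x _; exact: integral_ge0.
  - move=> x _ m n mn; apply: ge0_le_integral => //.
    + exact: mx.
    + exact: mx.
    + by move=> y _; exact: nd1.
  apply: eq_integral => x _; rewrite monotone_convergence//.
  - by move=> n; exact: mx.
change (I G = I (G \o sw)).
have ms F : measurable_fun setT F -> measurable_fun setT (F \o sw : _ ->
  \bar R).
  by move=> mF; exact: measurableT_comp.
apply: (@ge0_measurable_ind _ _ _ (fun F => I F = I (F \o sw))) G mG G0.
- move=> C mC; rewrite /I.
  have Ex x : (\int[P x]_y (\1_C (x, y))%:E = P x (xsection C x))%E.
    rewrite -[in RHS](setIT (xsection C x)) -integral_indic//;
      last exact: measurable_xsection.
    by apply: eq_integral => y _; rewrite !indicE mem_xsection.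
  have Ey x : (\int[P x]_y (\1_C (sw (x, y)))%:E = P x (ysection C x))%E.
    rewrite -[in RHS](setIT (ysection C x)) -integral_indic//;
      last exact: measurable_ysection.
    by apply: eq_integral => y _; rewrite !indicE mem_ysection.
  under eq_integral do rewrite Ex.
  under [RHS]eq_integral do rewrite /= Ey.
  exact: rev.
- move=> F1 F2 m1 m2 p1 p2 h1 h2; rewrite (ID _ _ m1 m2 p1 p2) h1 h2.
  exact/esym/(ID (F1 \o sw) (F2 \o sw) (ms _ m1) (ms _ m2)
    (fun=> p1 _) (fun=> p2 _)).
- move=> k F k0 m p h; rewrite (IZ _ _ k0 m p) h.
  exact/esym/(IZ k (F \o sw) k0 (ms _ m) (fun=> p _)).
- move=> f_ m p nd h; rewrite (Il _ m p nd).
  under eq_fun do rewrite h.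
  exact/esym/(Il (fun n => f_ n \o sw) (fun n => ms _ (m n)) (fun _ _ => p _ _)
    (fun=> nd _)).
Qed.
End kernel_integrals.

(** * Square-integrable functions *)

Section mass_one.
Context d {T : measurableType d} {R : realType}.
Variables (mu : {measure set T -> \bar R}) (mu1 : mu setT = 1%E).
Implicit Types f g : T -> R.

Lemma integrable_cst1 (c : R) : mu.-integrable setT (fun=> c%:E).
Proof.
apply/integrableP; split => //; rewrite integral_cst//= mu1 mule1.
exact: ltry.
Qed.

Lemma Rintegral_cst1 (c : R) : \int[mu]_x c = c.
Proof. by rewrite Rintegral_cst// mu1/= mulr1. Qed.

Lemma integrable_of_sqr f : measurable_fun setT f ->
  mu.-integrable setT (fun x => (f x ^+ 2)%:E) ->
  mu.-integrable setT (fun x => (f x)%:E).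
Proof.
move=> mf if2.
apply: (@le_integrable _ _ _ mu setT measurableT _ (fun x => (1 + f x ^+
  2)%:E)).
- exact/measurable_EFinP.
- move=> x _; rewrite !abse_EFin lee_fin [leRHS]ger0_norm ?addr_ge0 ?sqr_ge0//.
  rewrite -(ger0_norm (sqr_ge0 (f x))) normrX.
  have := sqr_ge0 (`|f x| - 1); have := normr_ge0 (f x); nra.
- under eq_fun do rewrite EFinD.
  exact: integrableD (integrable_cst1 1) if2.
Qed.

(** Jensen's inequality from the nonnegativity of the variance. When [f ^ 2] is not integrable the
    right side is [+oo], so the bound also covers points where the real integral takes a default
    value. Only total mass one is required of [mu], which makes it applicable to every [P x]. *)
Lemma sqr_Rintegral_le f : measurable_fun setT f ->
  (((\int[mu]_x f x) ^+ 2)%:E <= \int[mu]_x (f x ^+ 2)%:E)%E.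
Proof.
move=> mf; have mf2 : measurable_fun setT (fun x => (f x ^+ 2)%:E).
  by apply/measurable_EFinP; exact: measurable_funX.
have f20 x : (0 <= (f x ^+ 2)%:E)%E by rewrite lee_fin sqr_ge0.
have [if2|] := pselect (mu.-integrable setT (fun x => (f x ^+ 2)%:E));
  last first.
  move=> nif2; suff -> : (\int[mu]_x (f x ^+ 2)%:E = +oo)%E by rewrite leey.
  apply: contrapT => /eqP; rewrite -ltey => h; apply: nif2.
  apply/integrableP; split => //.
  by under eq_integral do rewrite gee0_abs//.
have if1 := integrable_of_sqr mf if2.
set c := \int[mu]_x f x.
have : 0 <= \int[mu]_x (f x ^+ 2 - 2 * c * f x + c ^+ 2).
  by apply: Rintegral_ge0 => x _; have := sqr_ge0 (f x - c); nra.
have i2 : mu.-integrable setT (fun x => (2 * c * f x)%:E).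
  by under eq_fun do rewrite EFinM; exact: integrableZl.
rewrite RintegralD//; last 2 first.
- exact: (integrableB _ if2 i2).
- exact: integrable_cst1.
rewrite RintegralB// RintegralZl// Rintegral_cst1 -/c => h.
rewrite -[leRHS]fineK; last exact: integrable_fin_num.
rewrite lee_fin -/(Rintegral _ _ _); nra.
Qed.

End mass_one.

Section square_integrable.
Context d {T : measurableType d} {R : realType} (mu : probability T R).
Implicit Types f g h : T -> R.

Definition sqint f := measurable_fun setT f /\
  mu.-integrable setT (fun x => (f x ^+ 2)%:E).

Definition inner f g := \int[mu]_x (f x * g x).

Lemma sqint_LfunP f : f \in Lfun mu 2%:E <-> sqint f.
Proof.
split => [fL|[mf if2]].
  split; last exact: Lfun2_integrable_sqr.
  by move: fL; rewrite inE => /andP[+ _]; rewrite inE/=.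
rewrite inE; apply/andP; split; rewrite inE//=.
rewrite /finite_norm unlock poweR_lty//.
under eq_integral do rewrite /= powR_mulrn// -normrX ger0_norm ?sqr_ge0//.
exact: integrable_lty.
Qed.

Lemma sqintM f g : sqint f -> sqint g ->
  mu.-integrable setT (fun x => (f x * g x)%:E).
Proof.
move=> [mf f2] [mg g2].
apply: (@le_integrable _ _ _ mu setT measurableT _
  (fun x => (f x ^+ 2 + g x ^+ 2)%:E)).
- by apply/measurable_EFinP; exact: measurable_funM.
- move=> x _; rewrite !abse_EFin lee_fin [leRHS]ger0_norm ?addr_ge0 ?sqr_ge0//.
  rewrite ler_norml; have := sqr_ge0 (f x - g x); have := sqr_ge0 (f x + g x).
  by have := sqr_ge0 (f x); have := sqr_ge0 (g x) => *; apply/andP; split; nra.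
- by under eq_fun do rewrite EFinD; exact: integrableD.
Qed.

Lemma sqint_bounded f (M : R) : measurable_fun setT f ->
  (forall x, `|f x| <= M) -> sqint f.
Proof.
move=> mf fM; split => //.
apply: (@le_integrable _ _ _ mu setT measurableT _ (fun=> (M ^+ 2)%:E)).
- by apply/measurable_EFinP; exact: measurable_funX.
- move=> x _; rewrite !abse_EFin lee_fin normrX [leRHS]ger0_norm ?sqr_ge0//.
  by rewrite lerXn2r ?nnegrE// (le_trans _ (fM x)).
- by apply: integrable_cst1; exact: probability_setT.
Qed.

Lemma sqint_cst (c : R) : sqint (fun=> c).
Proof. exact: (sqint_bounded (M := `|c|)). Qed.

Lemma sqintD f g : sqint f -> sqint g -> sqint (fun x => f x + g x).
Proof.
move=> sf sg; have [mf f2] := sf; have [mg g2] := sg.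
split; first exact: measurable_funD.
have := sqintM sf sg => fg.
apply: (@eq_integrable _ _ _ mu _ measurableT
  (fun x => ((f x ^+ 2)%:E + (2%:E * (f x * g x)%:E + (g x ^+ 2)%:E))%E)).
  by move=> x _; rewrite -EFinM -!EFinD; congr EFin; ring.
by apply: integrableD => //; apply: integrableD => //; exact: integrableZl.
Qed.

Lemma sqintZ (c : R) f : sqint f -> sqint (fun x => c * f x).
Proof.
move=> [mf f2]; split; first exact: measurable_funM.
by under eq_fun do rewrite exprMn EFinM; exact: integrableZl.
Qed.

Lemma sqintB f g : sqint f -> sqint g -> sqint (fun x => f x - g x).
Proof.
move=> sf sg; under eq_fun do rewrite -[X in _ + X]mulN1r.
by apply: sqintD => //; exact: sqintZ.
Qed.

Lemma sqint_le f g : sqint g -> measurable_fun setT f ->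
  (forall x, `|f x| <= `|g x|) -> sqint f.
Proof.
move=> [mg g2] mf fg; split => //.
apply: (le_integrable measurableT _ _ g2).
  by apply/measurable_EFinP; exact: measurable_funX.
by move=> x _; rewrite lee_fin !normrX lerXn2r ?nnegrE.
Qed.

Lemma sqint_integrable f : sqint f -> mu.-integrable setT (fun x => (f x)%:E).
Proof.
by case => mf f2; apply: integrable_of_sqr => //; exact: probability_setT.
Qed.

Lemma innerC f g : inner f g = inner g f.
Proof. by apply: eq_Rintegral => x _; rewrite mulrC. Qed.


Lemma innerDl f g h : sqint f -> sqint g -> sqint h ->
  inner (fun x => f x + g x) h = inner f h + inner g h.
Proof.
move=> sf sg sh; rewrite /inner -RintegralD//; [|exact: sqintM|exact: sqintM].
by apply: eq_Rintegral => x _; rewrite mulrDl.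
Qed.

Lemma innerZl (c : R) f h : sqint f -> sqint h ->
  inner (fun x => c * f x) h = c * inner f h.
Proof.
move=> sf sh; rewrite /inner -RintegralZl//; last exact: sqintM.
by apply: eq_Rintegral => x _; rewrite mulrA.
Qed.

Lemma innerBl f g h : sqint f -> sqint g -> sqint h ->
  inner (fun x => f x - g x) h = inner f h - inner g h.
Proof.
move=> sf sg sh; rewrite /inner -RintegralB//; [|exact: sqintM|exact: sqintM].
by apply: eq_Rintegral => x _; rewrite mulrBl.
Qed.

Lemma inner_ge0 f : 0 <= inner f f.
Proof. by apply: Rintegral_ge0 => x _; rewrite -expr2 sqr_ge0. Qed.

Lemma inner_cst (c : R) f : sqint f -> inner (fun=> c) f = c * \int[mu]_x f x.
Proof. by move=> sf; rewrite -RintegralZl//; exact: sqint_integrable. Qed.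

Lemma Rintegral_probability_cst (c : R) : \int[mu]_x c = c.
Proof. by apply: Rintegral_cst1; exact: probability_setT. Qed.

Lemma inner1 f : inner f (fun=> 1) = \int[mu]_x f x.
Proof. by apply: eq_Rintegral => x _; rewrite mulr1. Qed.

Lemma inner_EFin f : sqint f -> (inner f f)%:E = (\int[mu]_x (f x ^+ 2)%:E)%E.
Proof.
move=> [mf f2]; rewrite /inner /Rintegral fineK; first by apply: eq_integral.
exact: integrable_fin_num.
Qed.

Lemma eq_ae_inner f g h : sqint f -> sqint g -> sqint h ->
  {ae mu, forall x, f x = g x} -> inner f h = inner g h.
Proof.
move=> sf sg sh fg; congr fine; apply: ae_eq_integral => //.
- by have /integrableP[] := sqintM sf sh.
- by have /integrableP[] := sqintM sg sh.
- by apply: filterS fg => x /= -> _.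
Qed.

Lemma inner_eq0_ae f : sqint f -> inner f f = 0 -> {ae mu, forall x, f x = 0}.
Proof.
move=> sf f0; have := inner_EFin sf; rewrite f0 => /esym h.
have mf2 : measurable_fun setT (fun x => (f x ^+ 2)%:E).
  by case: sf => mf _; apply/measurable_EFinP; exact: measurable_funX.
have := (ae_eq_integral_abs mu measurableT mf2).1.
under eq_integral do rewrite gee0_abs ?lee_fin ?sqr_ge0//.
move=> /(_ h); apply: filterS => x /= /(_ Logic.I) [] /eqP.
by rewrite sqrf_eq0 => /eqP.
Qed.

Lemma cauchy_schwarz f g : sqint f -> sqint g ->
  inner f g ^+ 2 <= inner f f * inner g g.
Proof.
move=> sf sg.
have key t : 0 <= inner f f - 2 * t * inner f g + t ^+ 2 * inner g g.
  have stg := sqintZ t sg.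
  pose h x := f x - t * g x.
  have sh : sqint h by exact: sqintB.
  have := inner_ge0 h; rewrite {1}/h innerBl// innerZl//.
  rewrite (innerC f h) (innerC g h) /h !innerBl// !innerZl// (innerC g f).
  by move=> ?; nra.
have := inner_ge0 g; rewrite le_eqVlt => /predU1P[g0|g0].
  have [->|fg0] := eqVneq (inner f g) 0; first by rewrite expr2 mul0r -g0 mulr0.
  (* With [inner g g = 0] the quadratic in [t] is affine, and this [t] gives it the value -1. *)
  have := key ((inner f f + 1) / 2 / inner f g).
  rewrite -g0 mulr0 addr0 (_ : 2 * _ * _ = inner f f + 1); last by field.
  by move=> h; exfalso; move: h; lra.
have := key (inner f g / inner g g).
have -> : inner f f - 2 * (inner f g / inner g g) * inner f g +
    (inner f g / inner g g) ^+ 2 * inner g g =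
    (inner f f * inner g g - inner f g ^+ 2) / inner g g.
  by field; rewrite gt_eqF.
by rewrite pmulr_lge0 ?invr_gt0// subr_ge0.
Qed.

End square_integrable.

(** * The kernel on square-integrable functions *)

Section kernel_L2.
Context {d} {X : measurableType d} {R : realType}.
Variables (P : R.-pker X ~> X) (pi : probability X R).
Hypothesis rev : reversible pi P.
Implicit Types f g h : X -> R.

Let P1 x : P x setT = 1%E. Proof. exact: prob_kernel. Qed.

(** Reversibility for [G (x, y) = g y]: after the exchange the inner integrand is constant and [P x]
    has mass one. *)
Lemma integral_invariant (g : X -> \bar R) :
  measurable_fun setT g -> (forall x, 0 <= g x)%E ->
  (\int[pi]_x \int[P x]_y g y = \int[pi]_x g x)%E.
Proof.
move=> mg g0; rewrite (reversible_integral (G := fun z => g z.2) rev)//.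
- by apply: eq_integral => x _ /=; rewrite integral_cst// P1 mule1.
- by apply: measurableT_comp => //; exact: measurable_snd.
Qed.

(** By invariance the integral of [P |f|] is that of [|f|], hence finite, so [P |f|] is finite
    almost everywhere. This is the source of every almost-everywhere linearity of [kop]. *)
Lemma ae_kernel_integrable (f : X -> \bar R) : pi.-integrable setT f ->
  {ae pi, forall x, (P x).-integrable setT f}.
Proof.
move=> fi; have /integrableP[mf foo] := fi.
have mg : measurable_fun setT (fun x => \int[P x]_y `|f y|)%E.
  by apply: measurable_int_kernel => //; exact: measurableT_comp.
have : pi.-integrable setT (fun x => \int[P x]_y `|f y|)%E.
  apply/integrableP; split=> //.
  under eq_integral do rewrite gee0_abs ?integral_ge0//.
  by rewrite integral_invariant//; exact: measurableT_comp.
move=> /(integrable_ae measurableT); apply: filterS => x /= /(_ Logic.I) h.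
by apply/integrableP; split => //; rewrite ltey_eq h.
Qed.

Lemma measurable_kop f : measurable_fun setT f -> measurable_fun setT (kop P f).
Proof.
move=> mf; rewrite /kop /Rintegral; apply: measurableT_comp => //.
have mF : measurable_fun setT (EFin \o f) by exact/measurable_EFinP.
under eq_fun do rewrite integralE.
apply: emeasurable_funB; apply: measurable_int_kernel => //.
- exact: measurable_funepos.
- exact: measurable_funeneg.
Qed.

Lemma kop_cst (c : R) x : kop P (fun=> c) x = c.
Proof. by rewrite /kop Rintegral_cst1. Qed.

Lemma kopB f g x : (P x).-integrable setT (EFin \o f) ->
  (P x).-integrable setT (EFin \o g) ->
  kop P (fun y => f y - g y) x = kop P f x - kop P g x.
Proof. by move=> fi gi; rewrite /kop RintegralB. Qed.

Lemma sqint_ae_integrable f : sqint pi f ->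
  {ae pi, forall x, (P x).-integrable setT (EFin \o f)}.
Proof. by move=> sf; apply: ae_kernel_integrable; exact: sqint_integrable. Qed.

(** Jensen at each [x], followed by invariance. *)
Lemma kop_sqr_le f : sqint pi f ->
  (\int[pi]_x ((kop P f x) ^+ 2)%:E <= \int[pi]_x (f x ^+ 2)%:E)%E.
Proof.
move=> [mf f2].
have mf2 : measurable_fun setT (fun x => (f x ^+ 2)%:E).
  by apply/measurable_EFinP; exact: measurable_funX.
have f20 x : (0 <= (f x ^+ 2)%:E)%E by rewrite lee_fin sqr_ge0.
rewrite -[leRHS]integral_invariant//.
apply: ge0_le_lower_integral => x; first by rewrite lee_fin sqr_ge0.
exact: sqr_Rintegral_le.
Qed.

Lemma sqint_kop f : sqint pi f -> sqint pi (kop P f).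
Proof.
move=> sf; have [mf f2] := sf; have mk := measurable_kop mf; split => //.
apply/integrableP; split.
  by apply/measurable_EFinP; exact: measurable_funX.
under eq_integral do rewrite gee0_abs ?lee_fin ?sqr_ge0//.
by apply: le_lt_trans (kop_sqr_le sf) _; exact: integrable_lty.
Qed.

(** Transfers the quadratic form to an extended-real double integral, the form in which
    reversibility can be used. *)
Lemma inner_kop_ge0 f g : sqint pi f -> sqint pi g ->
  (forall x, 0 <= f x) -> (forall x, 0 <= g x) ->
  (inner pi (kop P f) g)%:E =
  (\int[pi]_x \int[P x]_y (f y * g x)%:E)%E.
Proof.
move=> sf sg f0 g0; rewrite /inner /Rintegral fineK; last first.
  exact/integrable_fin_num/sqintM/sg/sqint_kop.
have [mf _] := sf; have [mg _] := sg; have mk := measurable_kop mf.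
have mfg : measurable_fun setT (fun z : X * X => (f z.2 * g z.1)%:E).
  apply/measurable_EFinP; apply: measurable_funM.
    exact: measurableT_comp mf measurable_snd.
  exact: measurableT_comp mg measurable_fst.
apply: ae_eq_integral => //.
- by apply/measurable_EFinP; exact: measurable_funM.
- apply: (measurable_int_kernel2 P mfg) => z.
  by rewrite lee_fin mulr_ge0.
- apply: filterS (sqint_ae_integrable sf) => x fi _.
  under eq_integral do rewrite EFinM.
  rewrite integralZr// EFinM; congr (_ * _)%E.
  by rewrite /kop /Rintegral fineK//; exact: integrable_fin_num.
Qed.

Let inner_kopC_ge0 f g : sqint pi f -> sqint pi g ->
  (forall x, 0 <= f x) -> (forall x, 0 <= g x) ->
  inner pi (kop P f) g = inner pi f (kop P g).
Proof.
move=> sf sg f0 g0; apply: EFin_inj;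
  rewrite [inner _ f _]innerC !inner_kop_ge0//.
have [mf _] := sf; have [mg _] := sg.
have mfg : measurable_fun setT (fun z : X * X => (f z.2 * g z.1)%:E).
  apply/measurable_EFinP; apply: measurable_funM.
    exact: measurableT_comp mf measurable_snd.
  exact: measurableT_comp mg measurable_fst.
rewrite (reversible_integral (G := fun z => (f z.2 * g z.1)%:E) rev)//.
- by under eq_integral do under eq_integral do rewrite mulrC.
- by move=> z; rewrite lee_fin mulr_ge0.
Qed.

Let pos f x := Num.max (f x) 0.
Let neg f x := Num.max (- f x) 0.

Let posneg f : f = fun x => pos f x - neg f x.
Proof. by apply/funext => x; rewrite /pos /neg; case: (leP (f x) 0) => ?;
  case: (leP (- f x) 0) => ?; lra. Qed.

Let sqint_pos f : sqint pi f -> sqint pi (pos f).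
Proof.
move=> sf; apply: (sqint_le sf) => [|x].
  by apply: measurable_maxr => //; case: sf.
by rewrite /pos; case: (leP (f x) 0) => _ //; rewrite normr0.
Qed.

Let sqint_neg f : sqint pi f -> sqint pi (neg f).
Proof.
move=> sf; apply: (sqint_le sf) => [|x].
  by apply: measurable_maxr => //; apply: measurableT_comp => //; case: sf.
by rewrite /neg; case: (leP (- f x) 0) => _; rewrite ?normr0 ?normrN.
Qed.

Let pos_ge0 f x : 0 <= pos f x. Proof. by rewrite /pos le_max lexx orbT. Qed.
Let neg_ge0 f x : 0 <= neg f x. Proof. by rewrite /neg le_max lexx orbT. Qed.

Lemma inner_kopB f g h : sqint pi f -> sqint pi g -> sqint pi h ->
  inner pi (kop P (fun x => f x - g x)) h =
  inner pi (kop P f) h - inner pi (kop P g) h.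
Proof.
move=> sf sg sh; rewrite -innerBl//; try exact: sqint_kop.
apply: eq_ae_inner => //.
- exact/sqint_kop/sqintB.
- by apply: sqintB; exact: sqint_kop.
- by apply: filterS2 (sqint_ae_integrable sf) (sqint_ae_integrable sg) => x;
  exact: kopB.
Qed.

(** Self-adjointness follows from the nonnegative case by splitting one argument at a time into
    positive and negative parts; [half] is the stage where only the second argument has a sign. *)
Lemma inner_kopC f g : sqint pi f -> sqint pi g ->
  inner pi (kop P f) g = inner pi f (kop P g).
Proof.
move=> sf sg.
have half u v : sqint pi u -> sqint pi v -> (forall x, 0 <= v x) ->
    inner pi (kop P u) v = inner pi u (kop P v).
  move=> su sv v0; have [sp sn] := (sqint_pos su, sqint_neg su).
  rewrite [in LHS](posneg u) inner_kopB// [in RHS](posneg u) innerBl//;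
    last exact: sqint_kop.
  by rewrite !inner_kopC_ge0.
have [sp sn] := (sqint_pos sg, sqint_neg sg).
rewrite [inner _ f _]innerC [in RHS](posneg g) inner_kopB//.
rewrite [in LHS](posneg g) innerC innerBl//; last exact: sqint_kop.
by rewrite (innerC _ (pos g)) (innerC _ (neg g)) (half f (pos g))//
  (half f (neg g))// !(innerC _ f).
Qed.

Lemma Rintegral_kop f : sqint pi f -> \int[pi]_x kop P f x = \int[pi]_x f x.
Proof.
move=> sf; rewrite -inner1 inner_kopC//; last exact: sqint_cst.
by rewrite -[RHS]inner1; apply: eq_Rintegral => x _; rewrite kop_cst.
Qed.

End kernel_L2.

(** * Contraction on centered functions *)

Section contraction.
Context {d} {X : measurableType d} {R : realType}.
Variables (P : R.-pker X ~> X) (pi : probability X R).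
Hypothesis rev : reversible pi P.
Variables (A : set X) (q : R).
Hypotheses (q0 : 0 < q) (q1 : q <= 1).
Variable W : X -> \bar R.
Hypotheses (mW : measurable_fun setT W) (W1 : forall x, (1 <= W x)%E).
Hypothesis Wfin : {ae pi, forall x, (W x < +oo)%E}.
Hypothesis drift : forall x, ~ A x -> (\int[P x]_y W y <= q%:E * W x)%E.
Implicit Types f g h : X -> R.

Lemma normr_kop_le g x : measurable_fun setT g ->
  `|kop P g x| <= kop P (fun y => `|g y|) x.
Proof.
move=> mg; have [fin|nfin] := boolP ((\int[P x]_y (g y)%:E)%E \is a fin_num).
  apply: le_normr_Rintegral => //; apply/integrableP; split.
    exact/measurable_EFinP.
  by rewrite integral_fin_num_abs.
(* A non-finite integral makes [kop P g x] equal to the default 0, so the inequality holds at every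
   point. *)
rewrite [X in `|X|](_ : _ = 0); last first.
  by rewrite /kop /Rintegral; case: (integral _ _ _) nfin.
by rewrite normr0; apply: Rintegral_ge0.
Qed.

(* For the killed kernel, AM-GM gives
   [2 |g(x) g(y)| <= g(x)^2 W(y) / W(x) + g(y)^2 W(x) / W(y)];
   by reversibility both terms have the same integral, which the drift
   condition bounds. *)
Lemma inner_kop_le_off_atom g : sqint pi g -> (forall x, A x -> g x = 0) ->
  inner pi (kop P g) g <= q * inner pi g g.
Proof.
move=> sg gA; have [mg g2] := sg.
(* A real, everywhere positive version of [W]: since [fine +oo] is 0, the maximum with 1 is what
   allows division by [v] at all points. It satisfies [v <= W] everywhere, with equality almost
   everywhere. *)
pose v x := Num.max 1 (fine (W x)).
have v1 x : 1 <= v x by rewrite /v le_max lexx.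
have v0 x : 0 < v x by exact: lt_le_trans (v1 x).
have mv : measurable_fun setT v.
  by apply: measurable_maxr => //; exact: measurableT_comp.
have vW x : ((v x)%:E <= W x)%E.
  rewrite /v EFin_max ge_max W1/=.
  by have := W1 x; case: (W x) => [r| |]//= _; rewrite ?leey.
have vE : {ae pi, forall x, W x = (v x)%:E}.
  apply: filterS Wfin => x; rewrite /v; have := W1 x.
  by case: (W x) => [r| |]//=; rewrite lee_fin => /max_idPr ->.
have mav : measurable_fun setT (fun x => `|g x|) by exact: measurableT_comp.
have sag : sqint pi (fun x => `|g x|).
  by apply: (sqint_le sg) => // x; rewrite normr_id.
pose G (z : X * X) := (g z.1 ^+ 2 / v z.1 * v z.2).
have gv0 x : 0 <= g x ^+ 2 / v x by rewrite divr_ge0 ?sqr_ge0 ?ltW.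
have G0 z : 0 <= G z by apply: mulr_ge0 => //; exact: ltW.
have mgv : measurable_fun setT (fun x => g x ^+ 2 / v x).
  apply: measurable_funM; first exact: measurable_funX.
  under eq_fun do rewrite -powR_inv1 ?ltW//.
  exact: measurableT_comp (measurable_powR _) mv.
have mG : measurable_fun setT (EFin \o G).
  apply/measurable_EFinP; apply: measurable_funM.
    exact: measurableT_comp mgv measurable_fst.
  exact: measurableT_comp mv measurable_snd.
have mGs : measurable_fun setT (EFin \o (fun z => G (z.2, z.1))).
  by apply: measurableT_comp mG _; exact: measurable_swap.
apply: (@le_trans _ _ (inner pi (kop P (fun x => `|g x|)) (fun x => `|g x|))).
  apply: le_Rintegral => //.
  - by apply: sqintM => //; exact: sqint_kop.
  - by apply: sqintM => //; exact: sqint_kop.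
  - move=> x _; apply: le_trans (ler_norm _) _; rewrite normrM ler_wpM2r//.
    exact: normr_kop_le.
rewrite -lee_fin inner_kop_ge0// EFinM inner_EFin//.
apply: (@le_trans _ _ (\int[pi]_x \int[P x]_y (G (x, y))%:E)%E); last first.
  rewrite -ge0_integralZl//; last 3 first.
  - by apply/measurable_EFinP; exact: measurable_funX.
  - by move=> x _; rewrite lee_fin sqr_ge0.
  - by rewrite lee_fin ltW.
  apply: ae_ge0_le_integral => //.
  - by move=> x _; apply: integral_ge0 => y _; rewrite lee_fin.
  - exact: (measurable_int_kernel2 P mG).
  - by move=> x _; rewrite mule_ge0// lee_fin ?sqr_ge0 ?ltW.
  - by apply: measurable_funeM; apply/measurable_EFinP; exact: measurable_funX.
  apply: filterS vE => x Wx _; rewrite /G/=.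
  under eq_integral do rewrite EFinM.
  rewrite ge0_integralZl//; last 3 first.
  - exact/measurable_EFinP.
  - by move=> y _; rewrite lee_fin ltW.
  - by rewrite lee_fin.
  (* The drift is available only off [A]; on [A] the factor [g x ^+ 2] vanishes. *)
  have [Ax|nAx] := pselect (A x).
    by rewrite (gA x Ax) expr0n/= mul0r mul0e mule0.
  apply: (@le_trans _ _ ((g x ^+ 2 / v x)%:E * (q%:E * W x))%E).
    apply: lee_wpmul2l; first by rewrite lee_fin.
    apply: le_trans (drift nAx); apply: ge0_le_lower_integral => // y.
    by rewrite lee_fin ltW.
  rewrite Wx -!EFinM lee_fin le_eqVlt; apply/orP; left; apply/eqP.
  by field; rewrite gt_eqF.
(* Reversibility permits replacing [G] by its symmetrization, to which AM-GM applies pointwise. *)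
have -> : (\int[pi]_x \int[P x]_y (G (x, y))%:E =
    \int[pi]_x \int[P x]_y (2^-1 * (G (x, y) + G (y, x)))%:E)%E.
  have Ex x : (\int[P x]_y (2^-1 * (G (x, y) + G (y, x)))%:E =
      2^-1%:E * (\int[P x]_y (G (x, y))%:E + \int[P x]_y (G (y, x))%:E))%E.
    have my : measurable_fun setT (fun y => (G (x, y))%:E).
      exact: measurableT_comp mG (measurable_pair1 x).
    have mys : measurable_fun setT (fun y => (G (y, x))%:E).
      exact: measurableT_comp mGs (measurable_pair1 x).
    under eq_integral do rewrite EFinM EFinD.
    rewrite ge0_integralZl//.
    - by congr (_ * _)%E; apply: ge0_integralD => // y _; rewrite lee_fin.
    - exact: emeasurable_funD.
    - by move=> y _; rewrite adde_ge0 ?lee_fin.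
  under [RHS]eq_integral do rewrite Ex.
  have m1 := measurable_int_kernel2 P mG (fun z => G0 z).
  have m2 := measurable_int_kernel2 P mGs (fun z => G0 _).
  have p1 x : (0 <= \int[P x]_y (G (x, y))%:E)%E.
    by apply: integral_ge0 => y _; rewrite lee_fin.
  have p2 x : (0 <= \int[P x]_y (G (y, x))%:E)%E.
    by apply: integral_ge0 => y _; rewrite lee_fin.
  rewrite ge0_integralZl//; last 2 first.
  - exact: emeasurable_funD.
  - by move=> x _; rewrite adde_ge0.
  rewrite [X in (_ * X)%E]ge0_integralD//.
  have /= <- := reversible_integral rev mG (fun z => G0 z).
  set I := integral _ _ _; have : (0 <= I)%E by exact: integral_ge0.
  case: I => [r| |]// _; first by rewrite -EFinD -EFinM; congr EFin; field.
  by rewrite addye// gt0_muley.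
apply: ge0_le_lower_integral => x.
  by apply: integral_ge0 => y _; rewrite lee_fin mulr_ge0.
apply: ge0_le_lower_integral => y; first by rewrite lee_fin mulr_ge0.
rewrite lee_fin /G/=.
(* The gap in AM-GM is written as an explicit square. *)
have -> : 2^-1 * (g x ^+ 2 / v x * v y + g y ^+ 2 / v y * v x) =
   `|g y| * `|g x| + (`|g x| * v y - `|g y| * v x) ^+ 2 / (2 * v x * v y).
  rewrite -[in LHS](real_normK (num_real (g x))) -[in LHS](real_normK (num_real
    (g y))).
  by field; rewrite !gt_eqF.
by rewrite lerDl divr_ge0 ?sqr_ge0// ltW// !mulr_gt0.
Qed.

End contraction.

(** * From functions vanishing on the atom to all centered functions *)

Section atom_contraction.
Context {d} {X : measurableType d} {R : realType}.
Variables (P : R.-pker X ~> X) (pi : probability X R).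
Hypothesis rev : reversible pi P.
Hypothesis psd : nonneg_definite pi P.
Variables (A : set X) (q : R).
Hypotheses (q0 : 0 < q) (q1 : q <= 1).
Hypothesis accA : accessible_atom pi P A.
Hypothesis off_atom : forall g : X -> R, sqint pi g ->
  (forall x, A x -> g x = 0) -> inner pi (kop P g) g <= q * inner pi g g.
Implicit Types f g h : X -> R.

Let mA : measurable A. Proof. by case: accA => -[]. Qed.

Lemma kop_atom f x y : A x -> A y -> kop P f x = kop P f y.
Proof.
case: accA => -[_ [nu hnu]] _ Ax Ay; rewrite /kop /Rintegral; congr fine.
by apply: eq_measure_integral => B mB _; rewrite !hnu.
Qed.

Lemma atom_mass_gt0 : 0 < fine (pi A).
Proof.
case: accA => _ pA; apply: fine_gt0; rewrite pA/=.
by apply: le_lt_trans (probability_le1 _ mA) _; rewrite ltry.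
Qed.

Lemma atom_nonempty : exists a, A a.
Proof.
case: accA => _; apply: contraPP => /forallNP A0; apply/negP.
have -> : A = set0 by apply/seteqP; split => // x /A0.
by rewrite measure0 ltxx.
Qed.

Let idA : X -> R := \1_A.

Lemma sqint_indic : sqint pi idA.
Proof.
apply: (@sqint_bounded _ _ _ pi _ 1) => [|x]; first exact: measurable_indic.
by rewrite /idA indicE; case: (x \in A); rewrite ?normr1 ?normr0.
Qed.

Lemma sqintM_indic f : sqint pi f -> sqint pi (fun x => f x * idA x).
Proof.
move=> sf; apply: (sqint_le sf) => [|x].
  by apply: measurable_funM; [case: sf|exact: measurable_indic].
rewrite normrM ler_piMr// /idA indicE.
by case: (x \in A); rewrite ?normr1 ?normr0.
Qed.

Lemma Rintegral_indic1 : \int[pi]_x idA x = fine (pi A).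
Proof. by rewrite /Rintegral integral_indic// setIT. Qed.

(** With [c] the mean of [f] on [A], the part [b] of [f] is orthogonal to the range of [P] and to
    [u = f - b], and [g = u - c] vanishes on [A]. As [u] is centered, subtracting [c] adds [c ^+ 2]
    both to [<P u, u>] and to [<u, u>]. The bound for [g] thus reads
    [<P f, f> + c^2 <= q (<u, u> + c^2)], and [q <= 1] absorbs [c^2]. *)
Lemma Rintegral_eq0_gap f : sqint pi f -> \int[pi]_x f x = 0 ->
  inner pi (kop P f) f <= q * inner pi f f.
Proof.
move=> sf f0.
have pA := atom_mass_gt0.
pose c := (\int[pi]_x (f x * idA x)) / fine (pi A).
pose b x := (f x - c) * idA x.
pose u x := f x - b x.
pose g x := u x - c.
have sc := sqint_cst pi c.
have sb : sqint pi b by apply: sqintM_indic; exact: sqintB.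
have su : sqint pi u by exact: sqintB.
have sg : sqint pi g by exact: sqintB.
have b0 : \int[pi]_x b x = 0.
  rewrite /b; under eq_Rintegral do rewrite mulrBl.
  rewrite RintegralB//; last 2 first.
  - exact/sqint_integrable/sqintM_indic.
  - exact/sqint_integrable/sqintZ/sqint_indic.
  rewrite RintegralZl//; last exact/sqint_integrable/sqint_indic.
  by rewrite Rintegral_indic1 /c divfK ?subrr// gt_eqF.
(* On the atom [P h] is constant, while [b] is supported there and has mean zero. *)
have bk h : sqint pi h -> inner pi b (kop P h) = 0.
  move=> sh; have [a Aa] := atom_nonempty.
  rewrite /inner (@eq_Rintegral _ _ _ pi _ (fun x => kop P h a * b x));
    last first.
    move=> x _; rewrite mulrC /b /idA indicE.
    have [xA|_] := boolP (x \in A); last by rewrite mulr0 !mulr0.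
    by rewrite (kop_atom h (set_mem xA) Aa).
  by rewrite RintegralZl ?b0 ?mulr0//; exact: sqint_integrable.
have u0 : \int[pi]_x u x = 0.
  by rewrite RintegralB ?f0 ?b0 ?subrr//; exact: sqint_integrable.
have g0 : \int[pi]_x g x = - c.
  rewrite RintegralB ?u0//; try exact: sqint_integrable.
  by rewrite Rintegral_probability_cst sub0r.
have gA x : A x -> g x = 0.
  by move=> Ax; rewrite /g /u /b /idA indicE mem_set// mulr1; ring.
have ub : inner pi u b = 0.
  rewrite /inner (@eq_Rintegral _ _ _ pi _ (fun x => c * b x)); last first.
    move=> x _; have [xA|] := boolP (x \in A).
      by congr (_ * _); apply/eqP; rewrite -subr_eq0; apply/eqP/gA/set_mem.
    by rewrite /b /idA indicE => /negbTE ->; rewrite !mulr0.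
  by rewrite RintegralZl ?b0 ?mulr0//; exact: sqint_integrable.
have ff : inner pi f f = inner pi u u + inner pi b b.
  have fE : f = fun x => u x + b x by apply/funext => x; rewrite /u subrK.
  rewrite [in LHS]fE innerDl//; last exact: sqintD.
  rewrite (innerC _ u) (innerC _ b) !(@innerDl _ _ _ pi u b)//
    (innerC _ b u) ub; ring.
have sk h : sqint pi h -> sqint pi (kop P h) by exact: sqint_kop.
have kuu : inner pi (kop P u) u = inner pi (kop P f) f.
  rewrite {1}/u inner_kopB// (inner_kopC rev sb)// bk// subr0.
  by rewrite innerC /u innerBl// ?bk ?subr0 1?innerC//; exact: sk.
have kgg : inner pi (kop P g) g = inner pi (kop P u) u + c ^+ 2.
  have kc h : sqint pi h -> inner pi (kop P (fun=> c)) h = c * \int[pi]_x h x.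
    move=> sh; rewrite -inner_cst//; apply: eq_Rintegral => x _.
    by rewrite kop_cst.
  rewrite {1}/g inner_kopB// kc// g0 (innerC _ (kop P u)) innerBl//;
    last exact: sk.
  rewrite inner_cst; last exact: sk.
  rewrite Rintegral_kop// u0 innerC; ring.
have gg : inner pi g g = inner pi u u + c ^+ 2.
  by rewrite {1}/g innerBl// inner_cst// g0 innerC innerBl// inner_cst// u0;
    ring.
have := off_atom sg gA; rewrite kgg kuu gg ff.
have : 0 <= q * inner pi b b by rewrite mulr_ge0 ?inner_ge0// ltW.
have : 0 <= (1 - q) * c ^+ 2 by rewrite mulr_ge0 ?sqr_ge0// subr_ge0.
lra.
Qed.

(** Non-negativity at [h = f - q^-1 k], with [k = P f], gives
    [2 q^-1 <k, k> <= <k, f> + q^-2 <P k, k>]. The gap bounds for [f] and for [k] turn the right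
    side into at most [q <f, f> + q^-1 <k, k>]. This plays the role of Cauchy-Schwarz for the
    semidefinite form [<P f, g>]. *)
Lemma kop_contraction f : sqint pi f -> \int[pi]_x f x = 0 ->
  inner pi (kop P f) (kop P f) <= q ^+ 2 * inner pi f f.
Proof.
move=> sf f0; set k := kop P f.
have sk : sqint pi k by exact: sqint_kop.
have k0 : \int[pi]_x k x = 0 by rewrite Rintegral_kop.
have stk := sqintZ q^-1 sk.
pose h x := f x - q^-1 * k x.
have sh : sqint pi h by exact: sqintB.
have : 0 <= inner pi (kop P h) h.
  by rewrite innerC; apply: psd; exact/sqint_LfunP.
have kk : inner pi (kop P k) f = inner pi k k by rewrite inner_kopC.
have kZ v : sqint pi v ->
    inner pi (kop P (fun x => q^-1 * k x)) v = q^-1 * inner pi (kop P k) v.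
  move=> sv; rewrite (inner_kopC rev stk sv) (inner_kopC rev sk sv);
    apply: innerZl => //; exact: sqint_kop.
rewrite {1}/h inner_kopB// kZ//.
have hE v : sqint pi v -> inner pi v h = inner pi v f - q^-1 * inner pi v k.
  by move=> sv; rewrite innerC innerBl// innerZl// !(innerC _ v).
rewrite !hE; try exact: sqint_kop.
rewrite -/k kk => h0.
have := Rintegral_eq0_gap sf f0; have := Rintegral_eq0_gap sk k0.
rewrite -/k; set a := inner pi k k in h0 *;
  set b := inner pi (kop P k) k in h0 *.
set e := inner pi k f in h0 *; set n := inner pi f f => bq eq.
have : q ^- 2 * b <= q^-1 * a.
  rewrite -(ler_pM2l (exprn_gt0 2 q0)) mulVKf ?gt_eqF ?exprn_gt0//.
  by rewrite expr2 -mulrA mulVKf ?gt_eqF.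
have -> : q ^- 2 * b = q^-1 * (q^-1 * b) by rewrite mulrA -expr2 exprVn.
move=> h1; have : q^-1 * a <= q * n by lra.
by rewrite -(ler_pM2l q0) mulVKf ?gt_eqF// mulrA -expr2.
Qed.

End atom_contraction.

(** * The resolvent *)

(** Cauchy-Schwarz with weights [r ^ k], whose sum is at most [(1 - r)^-1]. It converts geometric
    decay of norms in L2 into pointwise control of partial sums. *)
Lemma sqr_sum_le_weighted (R : realFieldType) (r : R) (n : nat) (a : nat -> R) :
  0 < r -> r < 1 ->
  (\sum_(k < n) a k) ^+ 2 <= (1 - r)^-1 * \sum_(k < n) r ^- k * a k ^+ 2.
Proof.
move=> r0 r1; have r1' : 0 < 1 - r by rewrite subr_gt0.
elim: n a => [|n ih] a; first by rewrite !big_ord0 expr0n mulr0.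
rewrite !big_ord_recl /= expr0 invr1 mul1r.
set S := \sum_(i < n) a (bump 0 i); set Q := \sum_(i < n) _.
have Sle : S ^+ 2 / r <= (1 - r)^-1 * Q.
  rewrite ler_pdivrMr// -mulrA; apply: le_trans (ih (fun k => a k.+1)) _.
  rewrite ler_pM2l ?invr_gt0// /Q mulr_suml; apply: ler_sum => i _.
  rewrite /bump leq0n add1n (exprS r i) le_eqVlt; apply/orP; left; apply/eqP.
  by field; rewrite expf_neq0 gt_eqF.
(* The first term is split off with weights [1 - r] and [r]; the subtracted square is the gap. *)
have -> : (a 0%N + S) ^+ 2 = (1 - r)^-1 * a 0%N ^+ 2 + S ^+ 2 / r -
   (r * a 0%N - (1 - r) * S) ^+ 2 / (r * (1 - r)).
  by field; rewrite !gt_eqF.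
have : 0 <= (r * a 0%N - (1 - r) * S) ^+ 2 / (r * (1 - r)).
  by apply: divr_ge0; [exact: sqr_ge0|apply: mulr_ge0; exact: ltW].
rewrite mulrDr; lra.
Qed.

Lemma geometric_sum_le (R : realFieldType) (r : R) (n : nat) :
  0 < r -> r < 1 -> \sum_(k < n) r ^+ k <= (1 - r)^-1.
Proof.
move=> r0 r1; have r1' : 0 < 1 - r by rewrite subr_gt0.
rewrite -(ler_pM2l r1') mulfV ?gt_eqF//.
have -> : (1 - r) * (\sum_(k < n) r ^+ k) = 1 - r ^+ n.
  by rewrite -opprB mulNr -subrX1 opprB.
by rewrite gerBl exprn_ge0// ltW.
Qed.

Lemma Rintegral_ord_sum d (T : measurableType d) (R : realType)
    (mu : {measure set T -> \bar R}) (x : nat -> T -> R) (n : nat) :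
  (forall k, mu.-integrable setT (EFin \o x k)) ->
  \int[mu]_t (\sum_(k < n) x k t) = \sum_(k < n) \int[mu]_t x k t.
Proof.
move=> ix; rewrite /Rintegral.
under eq_integral do rewrite -sumEFin.
rewrite integral_sum//; last by move=> k; exact: ix.
by rewrite -sum_fine// => k _; apply: integrable_fin_num => //; exact: ix.
Qed.

(** * Almost-everywhere summation of geometrically small series in L2 *)

Section L2_series.
Context {d} {X : measurableType d} {R : realType}.
Variables (P : R.-pker X ~> X) (pi : probability X R).
Hypothesis rev : reversible pi P.
Variables (x : nat -> X -> R) (C r : R).
Hypotheses (r0 : 0 < r) (r1 : r < 1).
Hypothesis sx : forall k, sqint pi (x k).
Hypothesis xle : forall k, inner pi (x k) (x k) <= C * r ^+ (2 * k).

Let K := (1 - r)^-1.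
Let K0 : 0 < K. Proof. by rewrite invr_gt0 subr_gt0. Qed.
Let mx k : measurable_fun setT (x k). Proof. by case: (sx k). Qed.

(** The common majorant. The k-th term has integral at most
    [r ^- k * C * r ^+ (2 * k) = C * r ^+ k], so [D] has integral at most [C * K]. *)
Let D t := (\sum_(k <oo) (r ^- k * x k t ^+ 2)%:E)%E.

Let w0 k t : (0 <= (r ^- k * x k t ^+ 2)%:E)%E.
Proof. by rewrite lee_fin mulr_ge0 ?sqr_ge0// invr_ge0 exprn_ge0// ltW. Qed.

Let mw k : measurable_fun setT (fun t => (r ^- k * x k t ^+ 2)%:E).
Proof.
by apply/measurable_EFinP; apply: measurable_funM => //; exact: measurable_funX.
Qed.

Let D0 t : (0 <= D t)%E. Proof. exact: nneseries_ge0. Qed.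

Let mD : measurable_fun setT D.
Proof. exact: ge0_emeasurable_sum. Qed.

Let iD : pi.-integrable setT D.
Proof.
apply/integrableP; split => //.
under eq_integral do rewrite gee0_abs//.
rewrite integral_nneseries//.
apply: (@le_lt_trans _ _ (C * K)%:E); last by rewrite ltry.
apply: lime_le.
  by apply: is_cvg_nneseries => k _ _; exact: integral_ge0.
apply: nearW => n; rewrite big_mkord.
apply: (@le_trans _ _ (\sum_(k < n) (C * r ^+ k)%:E)%E).
  apply: lee_sum => k _; under eq_integral do rewrite EFinM.
  have rk : 0 <= r ^- k by rewrite invr_ge0 exprn_ge0// ltW.
  rewrite ge0_integralZl//; last 2 first.
  - by apply/measurable_EFinP; exact: measurable_funX.
  - by move=> t _; rewrite lee_fin sqr_ge0.
  rewrite -inner_EFin// -EFinM lee_fin;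
    apply: le_trans (ler_wpM2l rk (xle k)) _.
  rewrite mulrCA ler_wpM2l//.
    by have := xle 0; rewrite expr0 mulr1; apply: le_trans; exact: inner_ge0.
  by rewrite mul2n -addnn exprD mulKf// expf_neq0// gt_eqF.
rewrite sumEFin lee_fin -mulr_sumr ler_wpM2l//; last exact: geometric_sum_le.
by have := xle 0; rewrite expr0 mulr1; apply: le_trans; exact: inner_ge0.
Qed.

Let partial_le n t : (((\sum_(k < n) `|x k t|) ^+ 2)%:E <= K%:E * D t)%E.
Proof.
apply: (@le_trans _ _ (K%:E * (\sum_(k < n) r ^- k * x k t ^+ 2)%:E)%E).
  rewrite -EFinM lee_fin; apply: le_trans (sqr_sum_le_weighted n (fun k => `|x k
    t|) r0 r1) _.
  by under eq_bigr do rewrite real_normK ?num_real//.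
rewrite lee_pmul2l ?lte_fin// -sumEFin.
by have /(_ n) := @nneseries_lim_ge R _ xpredT 0 _ (fun k _ _ => w0 k t);
  rewrite big_mkord; apply.
Qed.

Let S n t := \sum_(k < n) x k t.

(** The inequality [a <= 1 + a ^ 2] turns control of squares into a dominating function for the
    partial sums themselves. *)
Let S_le n t : (`|(S n t)%:E| <= 1 + K%:E * D t)%E.
Proof.
apply: (@le_trans _ _ (1 + (\sum_(k < n) `|x k t|) ^+ 2)%:E); last first.
  by rewrite EFinD leeD2l// partial_le.
rewrite abse_EFin lee_fin; apply: le_trans (ler_norm_sum _ _ _) _.
by set a := \sum_(_ < _) _; have := sqr_ge0 (a - 1); have := sqr_ge0 a; nra.
Qed.

Let E : set X := [set t | (D t < +oo)%E].
Let mE : measurable E.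
Proof. by rewrite -[E]setTI; exact: emeasurable_fun_infty_o. Qed.

Let S_cvg t : E t -> cvgn (S ^~ t).
Proof.
move=> Et; have -> : S ^~ t = series (x ^~ t).
  by apply/funext => n; rewrite /series /= big_mkord.
apply: normed_cvg; apply: nondecreasing_is_cvgn.
  apply/nondecreasing_seqP => n; rewrite /normed_series_of seriesSr lerDl.
  exact: normr_ge0.
have Dfin : D t = (fine (D t))%:E.
  by rewrite fineK// ge0_fin_numE.
exists (1 + K * fine (D t)) => _ [n _ <-];
  rewrite /normed_series_of seriesEord /=.
have := partial_le n t; rewrite Dfin -EFinM lee_fin.
set a := \sum_(_ < _) _; have := sqr_ge0 (a - 1) => *; nra.
Qed.

(** The indicator of the convergence set makes the sequence converge at every point, so that the
    limit is measurable on the whole space. *)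
Let f t := limn (fun n => S n t * \1_E t).

Let f_in t : E t -> f t = limn (S ^~ t).
Proof.
by move=> Et; rewrite /f; congr (limn _); apply/funext => n;
  rewrite indicE mem_set// mulr1.
Qed.

Let f_out t : ~ E t -> f t = 0.
Proof.
move=> nEt; rewrite /f indicE memNset//.
under eq_fun do rewrite mulr0.
exact: lim_cst.
Qed.

Let f_cvg t : E t -> S n t @[n --> \oo] --> f t.
Proof. by move=> Et; rewrite f_in//; exact: S_cvg. Qed.

Let mS n : measurable_fun setT (S n).
Proof. exact: measurable_sum. Qed.

Let mf : measurable_fun setT f.
Proof.
apply: (@measurable_fun_cvg _ _ _ setT (fun n t => S n t * \1_E t)).
  by move=> n; apply: measurable_funM => //; exact: measurable_indic.
move=> t _; have [Et|nEt] := pselect (E t).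
  rewrite [X in X @ _ --> _](_ : _ = S ^~ t); first exact: f_cvg.
  by apply/funext => n; rewrite indicE mem_set// mulr1.
rewrite f_out//; under eq_fun do rewrite indicE memNset// mulr0.
exact: cvg_cst.
Qed.

Let f_le t : ((f t ^+ 2)%:E <= K%:E * D t)%E.
Proof.
have [Et|nEt] := pselect (E t); last first.
  by rewrite f_out// expr0n/= mule_ge0// lee_fin ltW.
have Dfin : D t = (fine (D t))%:E by rewrite fineK// ge0_fin_numE.
rewrite Dfin -EFinM lee_fin.
have h : (S n t) ^+ 2 @[n --> \oo] --> f t ^+ 2.
  by rewrite expr2; under eq_fun do rewrite expr2; apply: cvgM; exact: f_cvg.
rewrite -(cvg_lim _ h)//; apply: limr_le; first by apply: cvgP h.
apply: nearW => n; have := partial_le n t; rewrite Dfin -EFinM lee_fin.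
apply: le_trans; rewrite -real_normK ?num_real//.
by rewrite lerXn2r ?nnegrE ?sumr_ge0//; exact: ler_norm_sum.
Qed.

(** Dominated convergence for a general [m], because it serves twice: with [pi] for the mean of the
    limit, and with [P t] at almost every [t], where it lets [kop] pass through the series. *)
Let integral_cvg (m : {measure set X -> \bar R}) : m setT = 1%E ->
  m.-integrable setT D ->
  \int[m]_t S n t @[n --> \oo] --> \int[m]_t f t.
Proof.
move=> m1 iDm.
have iH : m.-integrable setT (fun t => 1 + K%:E * D t)%E.
  by apply: integrableD => //; [exact: integrable_cst1|exact: integrableZl].
have [] := @dominated_convergence _ _ _ m setT measurableT
  (fun n t => (S n t)%:E) (fun t => (f t)%:E) (fun t => 1 + K%:E * D t)%E.
- by move=> n; exact/measurable_EFinP.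
- exact/measurable_EFinP.
- apply: filterS (integrable_ae measurableT iDm) => t /(_ Logic.I) Dt _.
  by apply: cvg_EFin; [exact: nearW|apply: f_cvg; rewrite /E/= ltey_eq Dt].
- exact: iH.
- by apply: aeW => t n _; exact: S_le.
move=> fi _ h; apply: fine_cvg.
by rewrite fineK//; exact: integrable_fin_num.
Qed.

Lemma L2_series_cvg : exists g : X -> R,
  [/\ sqint pi g,
      {ae pi, forall t, \sum_(k < n) x k t @[n --> \oo] --> g t},
      {ae pi, forall t, \sum_(k < n) kop P (x k) t @[n --> \oo] --> kop P g t} &
      \sum_(k < n) \int[pi]_t x k t @[n --> \oo] --> \int[pi]_t g t].
Proof.
exists f; split.
- split => //.
  have iKD : pi.-integrable setT (fun t => K%:E * D t)%E by exact: integrableZl.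
  apply: le_integrable iKD => //.
    by apply/measurable_EFinP; exact: measurable_funX.
  move=> t _; have KD0 : (0 <= K%:E * D t)%E by rewrite mule_ge0// lee_fin ltW.
  rewrite (gee0_abs KD0) gee0_abs ?lee_fin ?sqr_ge0//.
- apply: filterS (integrable_ae measurableT iD) => t /(_ Logic.I) Dt.
  by apply: f_cvg; rewrite /E/= ltey_eq Dt.
- have h := ae_foralln (fun k => sqint_ae_integrable rev (sx k)).
  apply: filterS2 h (ae_kernel_integrable rev iD) => t xt Dt.
  have := integral_cvg (prob_kernel t) Dt.
  under eq_fun do rewrite (Rintegral_ord_sum _ xt).
  exact.
- have := integral_cvg (probability_setT pi) iD.
  under eq_fun do rewrite (Rintegral_ord_sum _ (fun k => sqint_integrable (sx
    k))).
  exact.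
Qed.

End L2_series.

(** The passage to the limit in the Neumann recursion: with [n.+1] terms of [a] and [b] against [n]
    terms of [c], everything cancels but the initial term. *)
Lemma series_telescope (R : realType) (a b c : nat -> R) (A B C s t h : R) :
  \sum_(k < n) a k @[n --> \oo] --> A ->
  \sum_(k < n) b k @[n --> \oo] --> B ->
  \sum_(k < n) c k @[n --> \oo] --> C ->
  s * a 0%N + t * b 0%N = h ->
  (forall k, s * a k.+1 + t * b k.+1 = c k) ->
  s * A + t * B - C = h.
Proof.
move=> aA bB cC h0 hS.
have lim1 : s * (\sum_(k < n.+1) a k) + t * (\sum_(k < n.+1) b k) -
    \sum_(k < n) c k @[n --> \oo] --> s * A + t * B - C.
  apply: cvgB => //; apply: cvgD; apply: cvgMl_tmp.
    by rewrite (cvg_shiftS (fun n => \sum_(k < n) a k)).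
  by rewrite (cvg_shiftS (fun n => \sum_(k < n) b k)).
rewrite -(cvg_lim _ lim1)//; apply: lim_near_cst => //; apply: nearW => n.
rewrite !big_ord_recl !mulrDr.
under [X in _ - X]eq_bigr do rewrite -hS.
by rewrite big_split/= -!mulr_sumr -h0; ring.
Qed.

(** * The resolvent equation as a system of two real equations *)

Section resolvent.
Context {d} {X : measurableType d} {R : realType}.
Variables (P : R.-pker X ~> X) (pi : probability X R).
Hypothesis rev : reversible pi P.
Variable q : R.
Hypothesis q0 : 0 < q.
Hypothesis contraction : forall f, sqint pi f -> \int[pi]_x f x = 0 ->
  inner pi (kop P f) (kop P f) <= q ^+ 2 * inner pi f f.

Definition centered (f : X -> R) := sqint pi f /\ \int[pi]_x f x = 0.

Lemma L2_0P f : L2_0 pi f <-> centered f.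
Proof. by split=> -[h f0]; split => //; apply/sqint_LfunP. Qed.

Lemma centered_kop f : centered f -> centered (kop P f).
Proof. by case=> sf f0; split; [exact: sqint_kop|rewrite Rintegral_kop]. Qed.

Lemma centered_comb (a b : R) f g : centered f -> centered g ->
  centered (fun x => a * f x + b * g x).
Proof.
move=> [sf f0] [sg g0]; have sa := sqintZ a sf; have sb := sqintZ b sg.
split; first exact: sqintD.
rewrite RintegralD//; try exact: sqint_integrable.
by rewrite !RintegralZl ?f0 ?g0 ?mulr0 ?addr0//; exact: sqint_integrable.
Qed.

(** Multiplicativity of the modulus, integrated: the two functions are the real and imaginary parts
    of [(a - i b) (f + i g)]. *)
Lemma inner_comb (a b : R) f g : sqint pi f -> sqint pi g ->
  inner pi (fun x => a * f x + b * g x) (fun x => a * f x + b * g x) +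
  inner pi (fun x => a * g x - b * f x) (fun x => a * g x - b * f x) =
  (a ^+ 2 + b ^+ 2) * (inner pi f f + inner pi g g).
Proof.
move=> sf sg.
have saf := sqintZ a sf; have sbf := sqintZ b sf.
have sag := sqintZ a sg; have sbg := sqintZ b sg.
pose F x := a * f x + b * g x; pose G x := a * g x - b * f x.
have sF : sqint pi F by exact: sqintD.
have sG : sqint pi G by exact: sqintB.
have FE v : sqint pi v -> inner pi F v = a * inner pi f v + b * inner pi g v.
  by move=> sv; rewrite /F innerDl// !innerZl.
have GE v : sqint pi v -> inner pi G v = a * inner pi g v - b * inner pi f v.
  by move=> sv; rewrite /G innerBl// !innerZl.
change (inner pi F F + inner pi G G = (a ^+ 2 + b ^+ 2) * (inner pi f f + inner
  pi g g)).
rewrite (FE F sF) (GE G sG) (innerC _ f F) (innerC _ g F) (innerC _ g G) (innerC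
  _ f G).
by rewrite (FE f sf) (FE g sg) (GE f sf) (GE g sg) (innerC _ g f); ring.
Qed.

Section parameters.
Variables (u v : R).
(** The modulus of [lam = u + i v]. *)
Let s := Num.sqrt (u ^+ 2 + v ^+ 2).
Hypothesis qs : q < s.

Let s0 : 0 < s. Proof. exact: lt_trans qs. Qed.
Let s2 : s ^+ 2 = u ^+ 2 + v ^+ 2.
Proof. by rewrite /s sqr_sqrtr// addr_ge0 ?sqr_ge0. Qed.

(* [|h + p|^2 <= s / (s - q) |h|^2 + s / q |p|^2] with [p = P g] *)
Lemma resolvent_bound g1 g2 h1 h2 :
  centered g1 -> centered g2 -> sqint pi h1 -> sqint pi h2 ->
  {ae pi, forall x, u * g1 x - v * g2 x - kop P g1 x = h1 x} ->
  {ae pi, forall x, v * g1 x + u * g2 x - kop P g2 x = h2 x} ->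
  inner pi g1 g1 + inner pi g2 g2 <=
  (s - q)^-1 ^+ 2 * (inner pi h1 h1 + inner pi h2 h2).
Proof.
move=> cg1 cg2 sh1 sh2 e1 e2.
have [[sg1 z1] [sg2 z2]] := (cg1, cg2).
pose k1 x := u * g1 x - v * g2 x - kop P g1 x.
pose k2 x := v * g1 x + u * g2 x - kop P g2 x.
have sk1 : sqint pi k1.
  by apply: sqintB (sqint_kop rev sg1); apply: sqintB; exact: sqintZ.
have sk2 : sqint pi k2.
  by apply: sqintB (sqint_kop rev sg2); apply: sqintD; exact: sqintZ.
(* Exchanging [h1] and [h2] for the left sides of the equations makes these hold at every point, as
   the pointwise comparison below requires. *)
have -> : inner pi h1 h1 = inner pi k1 k1.
  by rewrite -(eq_ae_inner sk1 sh1 sh1 e1) innerC -(eq_ae_inner sk1 sh1 sk1 e1).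
have -> : inner pi h2 h2 = inner pi k2 k2.
  by rewrite -(eq_ae_inner sk2 sh2 sh2 e2) innerC -(eq_ae_inner sk2 sh2 sk2 e2).
have sq : 0 < s - q by rewrite subr_gt0.
have hk1 := contraction sg1 z1; have hk2 := contraction sg2 z2.
set p1 := kop P g1 in hk1; set p2 := kop P g2 in hk2.
have sp1 : sqint pi p1 by exact: sqint_kop.
have sp2 : sqint pi p2 by exact: sqint_kop.
have : s ^+ 2 * (inner pi g1 g1 + inner pi g2 g2) <=
    s / (s - q) * (inner pi k1 k1 + inner pi k2 k2) +
    s / q * (inner pi p1 p1 + inner pi p2 p2).
  have i1 f : sqint pi f -> pi.-integrable setT (EFin \o (fun x => f x * f x)).
    by move=> sf; exact: sqintM.
  have i2 f g : sqint pi f -> sqint pi g ->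
      pi.-integrable setT (EFin \o (fun x => f x * f x + g x * g x)).
    by move=> sf sg; exact: (integrableD _ (i1 f sf) (i1 g sg)).
  have iZ c f g : sqint pi f -> sqint pi g ->
      pi.-integrable setT (EFin \o (fun x => c * (f x * f x + g x * g x))).
    by move=> sf sg; exact: (integrableZl _ c (i2 f g sf sg)).
  rewrite /inner -!RintegralD//; try exact: i1.
  rewrite -!RintegralZl//; try exact: i2.
  rewrite -RintegralD//; try exact: iZ.
  apply: le_Rintegral => //; first exact: iZ.
    exact: (integrableD _ (iZ _ k1 k2 sk1 sk2) (iZ _ p1 p2 sp1 sp2)).
  move=> x _; rewrite s2.
  have -> : (u ^+ 2 + v ^+ 2) * (g1 x * g1 x + g2 x * g2 x) =
      (k1 x + p1 x) ^+ 2 + (k2 x + p2 x) ^+ 2.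
    by rewrite /k1 /k2 !subrK; ring.
  have key a b : (a + b) ^+ 2 <= s / (s - q) * (a * a) + s / q * (b * b).
    have -> : s / (s - q) * (a * a) + s / q * (b * b) =
       (a + b) ^+ 2 + (q * a - (s - q) * b) ^+ 2 / (q * (s - q)).
      by field; rewrite !gt_eqF.
    by rewrite lerDl divr_ge0 ?sqr_ge0// ltW// mulr_gt0.
  by have := key (k1 x) (p1 x); have := key (k2 x) (p2 x); lra.
set G := _ + inner pi g2 g2; set H := _ + inner pi k2 k2.
move=> h.
(* The contraction bounds the [p] terms by [s q G]; moved to the left, this leaves
   [s^2 - s q = s (s - q)] in front of [G]. *)
have : s / q * (inner pi p1 p1 + inner pi p2 p2) <= s * q * G.
  have -> : s * q * G = s / q * (q ^+ 2 * G) by field; rewrite gt_eqF.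
  by rewrite ler_pM2l ?divr_gt0// /G mulrDr lerD.
move=> h'; have : s * (s - q) * G <= s / (s - q) * H.
  have -> : s * (s - q) * G = s ^+ 2 * G - s * q * G by ring.
  lra.
rewrite -mulrA -[X in _ <= X]mulrA ler_pM2l// -(ler_pM2l sq) mulVKf ?gt_eqF//
  => h''.
by rewrite expr2 -mulrA -(ler_pM2l sq) -(ler_pM2l sq) !mulVKf ?gt_eqF.
Qed.

(** [al - i be] is the inverse of [lam]. *)
Let al := u / s ^+ 2.
Let be := v / s ^+ 2.

(** Real and imaginary parts of [lam^-(n+1) P^n h], the n-th term of the Neumann series. *)
Fixpoint neumann (h : (X -> R) * (X -> R)) (n : nat) : (X -> R) * (X -> R) :=
  let w := if n is m.+1 then (kop P (neumann h m).1, kop P (neumann h m).2)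
           else h in
  (fun x => al * w.1 x + be * w.2 x, fun x => al * w.2 x - be * w.1 x).

Lemma centered_neumann h n : centered h.1 -> centered h.2 ->
  centered (neumann h n).1 /\ centered (neumann h n).2.
Proof.
move=> c1 c2.
have step f g : centered f -> centered g ->
    centered (fun x => al * f x + be * g x) /\ centered (fun x => al * g x - be
      * f x).
  move=> cf cg; split; first exact: centered_comb.
  under eq_fun do rewrite -mulNr; exact: centered_comb.
elim: n => [|n [ih1 ih2]] /=; first exact: step.
by apply: step; exact: centered_kop.
Qed.

Let r := q / s.

Let ab2 : al ^+ 2 + be ^+ 2 = s ^- 2.
Proof.
rewrite /al /be !expr_div_n -mulrDl -s2; field.
by rewrite gt_eqF.
Qed.

Lemma neumann_le h n : centered h.1 -> centered h.2 ->
  inner pi (neumann h n).1 (neumann h n).1 +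
  inner pi (neumann h n).2 (neumann h n).2 <=
  s ^- 2 * (inner pi h.1 h.1 + inner pi h.2 h.2) * r ^+ (2 * n).
Proof.
move=> c1 c2; elim: n => [|n ih].
  by rewrite /= inner_comb ?ab2 ?mulr1//; [case: c1|case: c2].
have [[s1 z1] [s2' z2]] := centered_neumann n c1 c2.
rewrite /= inner_comb; try exact: sqint_kop.
rewrite ab2 mulnS exprD mulrCA mulrC.
apply: (@le_trans _ _ (s ^- 2 * (q ^+ 2 * (inner pi (neumann h n).1 (neumann h
  n).1 +
  inner pi (neumann h n).2 (neumann h n).2)))).
  rewrite mulrC ler_pM2l ?invr_gt0 ?exprn_gt0// mulrDr.
  by apply: lerD; exact: contraction.
have -> : forall a, s ^- 2 * (q ^+ 2 * a) = r ^+ 2 * a.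
  by move=> a; rewrite /r; field; rewrite gt_eqF.
by rewrite ler_pM2l// exprn_gt0// divr_gt0.
Qed.

Let uv0 : u ^+ 2 + v ^+ 2 != 0.
Proof. by rewrite -s2 expf_neq0// gt_eqF. Qed.

(** With [inv2]: real and imaginary parts of [lam (lam^-1 (a + i b)) = a + i b]. *)
Let inv1 (a b : R) : u * (al * a + be * b) - v * (al * b - be * a) = a.
Proof. by rewrite /al /be s2; field. Qed.

Let inv2 (a b : R) : v * (al * a + be * b) + u * (al * b - be * a) = b.
Proof. by rewrite /al /be s2; field. Qed.

Lemma resolvent_exists h1 h2 : centered h1 -> centered h2 ->
  exists f1 f2, [/\ centered f1, centered f2,
   {ae pi, forall x, u * f1 x - v * f2 x - kop P f1 x = h1 x} &
   {ae pi, forall x, v * f1 x + u * f2 x - kop P f2 x = h2 x}].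
Proof.
move=> c1 c2; pose h := (h1, h2).
pose x1 n := (neumann h n).1; pose x2 n := (neumann h n).2.
have cx n : centered (x1 n) /\ centered (x2 n) by exact: centered_neumann.
have r0 : 0 < r by rewrite divr_gt0.
have r1 : r < 1 by rewrite ltr_pdivrMr ?mul1r.
pose C := s ^- 2 * (inner pi h1 h1 + inner pi h2 h2).
have le1 n : inner pi (x1 n) (x1 n) <= C * r ^+ (2 * n).
  by apply: le_trans (@neumann_le h n c1 c2); rewrite lerDl inner_ge0.
have le2 n : inner pi (x2 n) (x2 n) <= C * r ^+ (2 * n).
  by apply: le_trans (@neumann_le h n c1 c2); rewrite lerDr inner_ge0.
have [f1 [sf1 f1c kf1 if1]] :=
  L2_series_cvg rev r0 r1 (fun n => (cx n).1.1) le1.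
have [f2 [sf2 f2c kf2 if2]] :=
  L2_series_cvg rev r0 r1 (fun n => (cx n).2.1) le2.
have z (f : X -> R) (x : nat -> X ->
  R) : \sum_(k < n) \int[pi]_t x k t @[n --> \oo] --> \int[pi]_t f t ->
    (forall k, \int[pi]_t x k t = 0) -> \int[pi]_t f t = 0.
  move=> + x0; under eq_fun do under eq_bigr do rewrite x0.
  under eq_fun do rewrite sumr_const mul0rn.
  by move/cvg_lim => <- //; exact: lim_cst.
exists f1, f2; split.
- by split => //; apply: (z _ x1) if1 _ => k; exact: (cx k).1.2.
- by split => //; apply: (z _ x2) if2 _ => k; exact: (cx k).2.2.
- apply: filterS3 f1c f2c kf1 => t l1 l2 lk; rewrite -mulNr.
  apply: (@series_telescope _ (x1 ^~ t) (x2 ^~ t) (fun k => kop P (x1 k) t) _ _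
    _
    _ _ _ l1 l2 lk) => [|k]; rewrite /x1 /x2 /= mulNr.
    exact: inv1.
  exact: inv1.
- apply: filterS3 f1c f2c kf2 => t l1 l2 lk.
  apply: (@series_telescope _ (x1 ^~ t) (x2 ^~ t) (fun k => kop P (x2 k) t) _ _
    _
    _ _ _ l1 l2 lk) => [|k]; rewrite /x1 /x2 /=.
    exact: inv2.
  exact: inv2.
Qed.

End parameters.
End resolvent.

(** * The resolvent set outside the disc of radius [q] *)

Section spectral_radius.
Context {d} {X : measurableType d} {R : realType}.
Variables (P : R.-pker X ~> X) (pi : probability X R).
Hypothesis rev : reversible pi P.
Variable q : R.
Hypothesis q0 : 0 < q.
Hypothesis contraction : forall f, sqint pi f -> \int[pi]_x f x = 0 ->
  inner pi (kop P f) (kop P f) <= q ^+ 2 * inner pi f f.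

Lemma L2normCE (z : X -> R[i]) :
  sqint pi (fun x => complex.Re (z x)) ->
    sqint pi (fun x => complex.Im (z x)) ->
  L2normC pi z = (Num.sqrt
    (inner pi (fun x => complex.Re (z x)) (fun x => complex.Re (z x)) +
     inner pi (fun x => complex.Im (z x)) (fun x => complex.Im (z x))))%:E.
Proof.
move=> s1 s2; rewrite /L2normC unlock /=.
have E x : `|Normc.normc (z x)| `^ 2 =
    complex.Re (z x) ^+ 2 + complex.Im (z x) ^+ 2.
  have n0 : 0 <= Normc.normc (z x) by case: (z x) => a b; exact: sqrtr_ge0.
  rewrite ger0_norm// powR_mulrn//.
  by case: (z x) => a b; rewrite /= sqr_sqrtr// addr_ge0 ?sqr_ge0.
under eq_integral do rewrite E EFinD.
have [[m1 _] [m2 _]] := (s1, s2).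
rewrite ge0_integralD//; last 4 first.
- by move=> x _; rewrite lee_fin sqr_ge0.
- by apply/measurable_EFinP; exact: measurable_funX.
- by move=> x _; rewrite lee_fin sqr_ge0.
- by apply/measurable_EFinP; exact: measurable_funX.
rewrite -!inner_EFin// -EFinD poweR_EFin powR12_sqrt//.
by rewrite addr_ge0 ?inner_ge0.
Qed.

Lemma resolvent_eqP (lam : R[i]) (z h : X -> R[i]) x :
  lam * z x - kopC P z x = h x <->
  complex.Re lam * complex.Re (z x) - complex.Im lam * complex.Im (z x) -
    kop P (fun y => complex.Re (z y)) x = complex.Re (h x) /\
  complex.Im lam * complex.Re (z x) + complex.Re lam * complex.Im (z x) -
    kop P (fun y => complex.Im (z y)) x = complex.Im (h x).
Proof.
rewrite /kopC; case: lam => u v; case: (z x) => a b; case: (h x) => c e /=.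
rewrite (addrC (v * a)).
by split=> [[<- <-]|[<- <-]].
Qed.

Lemma gt_normc_resolvent (lam : R[i]) : q < Normc.normc lam ->
  resolvent_set pi P lam.
Proof.
move=> qlam; exists ((Normc.normc lam - q)^-1) => h [ch1 ch2].
move/L2_0P : ch1 => ch1; move/L2_0P : ch2 => ch2.
set u := complex.Re lam; set v := complex.Im lam.
have nE : Normc.normc lam = Num.sqrt (u ^+ 2 + v ^+ 2) by rewrite /u /v;
  case: lam {qlam u v}.
rewrite nE in qlam *.
have [f1 [f2 [cf1 cf2 e1 e2]]] :=
  resolvent_exists rev q0 contraction qlam ch1 ch2.
have [[sf1 z1] [sf2 z2]] := (cf1, cf2); have [[sh1 y1] [sh2 y2]] := (ch1, ch2).
exists (fun x => Complex (f1 x) (f2 x)); split.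
- by split; apply/L2_0P.
- by apply: filterS2 e1 e2 => x E1 E2; apply/resolvent_eqP.
- rewrite !L2normCE// -EFinM lee_fin /=.
  have b := resolvent_bound rev q0 contraction qlam cf1 cf2 sh1 sh2 e1 e2.
  have q1 : 0 <= (Num.sqrt (u ^+ 2 + v ^+ 2) - q)^-1 by rewrite invr_ge0
    subr_ge0 ltW.
  rewrite -[X in X * _](ger0_norm q1) -sqrtr_sqr -sqrtrM ?sqr_ge0//.
  exact: ler_wsqrtr.
(* Uniqueness: the difference of two solutions solves the homogeneous equation, and
   [resolvent_bound] with zero right side makes its norm vanish. *)
- move=> g [cg1 cg2] eg.
  move/L2_0P : cg1 => cg1; move/L2_0P : cg2 => cg2.
  set g1 := fun x => complex.Re (g x); set g2 := fun x => complex.Im (g x).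
  have diff a b : centered pi a -> centered pi b ->
    centered pi (fun x => a x - b x).
    move=> ca cb; have := centered_comb 1 (-1) ca cb.
    by under eq_fun do rewrite mul1r mulN1r.
  have kd a b : centered pi a -> centered pi b ->
      {ae pi, forall x, kop P (fun y => a y - b y) x = kop P a x - kop P b x}.
    move=> [sa _] [sb _].
    apply: filterS2 (sqint_ae_integrable rev sa) (sqint_ae_integrable rev sb) =>
      x.
    exact: kopB.
  have eg' : {ae pi, forall x,
      u * g1 x - v * g2 x - kop P g1 x = complex.Re (h x) /\
      v * g1 x + u * g2 x - kop P g2 x = complex.Im (h x)}.
    by apply: filterS eg => x /resolvent_eqP.
  have d1 : {ae pi, forall x, u * (g1 x - f1 x) - v * (g2 x - f2 x) -
      kop P (fun y => g1 y - f1 y) x = 0}.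
    apply: filterS3 eg' e1 (kd _ _ cg1 cf1) => x [E1 _] E2 ->.
    transitivity ((u * g1 x - v * g2 x - kop P g1 x) -
      (u * f1 x - v * f2 x - kop P f1 x)); first by ring.
    by rewrite E1 E2 subrr.
  have d2 : {ae pi, forall x, v * (g1 x - f1 x) + u * (g2 x - f2 x) -
      kop P (fun y => g2 y - f2 y) x = 0}.
    apply: filterS3 eg' e2 (kd _ _ cg2 cf2) => x [_ E1] E2 ->.
    transitivity ((v * g1 x + u * g2 x - kop P g2 x) -
      (v * f1 x + u * f2 x - kop P f2 x)); first by ring.
    by rewrite E1 E2 subrr.
  have c1 := diff _ _ cg1 cf1; have c2 := diff _ _ cg2 cf2.
  have := resolvent_bound rev q0 contraction qlam c1 c2
    (sqint_cst pi 0) (sqint_cst pi 0) d1 d2.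
  rewrite !inner_cst; try exact: sqint_cst.
  rewrite !mul0r addr0 mulr0.
  set I1 := inner _ _ _; set I2 := inner _ _ _ => I0.
  have I10 : I1 = 0.
    have := inner_ge0 pi (fun x => g1 x - f1 x).
    have := inner_ge0 pi (fun x => g2 x - f2 x); rewrite -/I1 -/I2; lra.
  have I20 : I2 = 0.
    have := inner_ge0 pi (fun x => g2 x - f2 x); rewrite -/I2; lra.
  apply: filterS2 (inner_eq0_ae c1.1 I10) (inner_eq0_ae c2.1 I20) => x.
  rewrite /g1 /g2; case: (g x) => a b /= /eqP.
  by rewrite subr_eq0 => /eqP -> /eqP; rewrite subr_eq0 => /eqP ->.
Qed.

Lemma r0_le : (r0 pi P <= q%:E)%E.
Proof.
apply: ge_ereal_sup => _ [lam lamS <-]; rewrite lee_fin leNgt.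
by apply/negP => /gt_normc_resolvent.
Qed.

End spectral_radius.

(** * Total variation *)

Section bounded_mass_one.
Context d {T : measurableType d} {R : realType}.
Variables (mu : {measure set T -> \bar R}) (mu1 : mu setT = 1%E).
Variables (f : T -> R) (M : R).
Hypotheses (mf : measurable_fun setT f) (fM : forall x, `|f x| <= M).

Lemma integrable_bounded1 : mu.-integrable setT (EFin \o f).
Proof.
apply: le_integrable (integrable_cst1 mu1 M) => //;
  first exact/measurable_EFinP.
by move=> x _; rewrite !abse_EFin lee_fin (le_trans (fM x))// ler_norm.
Qed.

Lemma normr_Rintegral_bounded1 : `|\int[mu]_x f x| <= M.
Proof.
apply: le_trans (le_normr_Rintegral _ integrable_bounded1) _ => //.
rewrite -[leRHS](Rintegral_cst1 mu1); apply: le_Rintegral => //.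
- exact: integrable_norm integrable_bounded1.
- exact: integrable_cst1.
Qed.

End bounded_mass_one.

(** * Iterated kernels and iterates of the operator on bounded functions *)

Section kernel_iterates.
Context {d} {X : measurableType d} {R : realType}.
Variable P : R.-pker X ~> X.
Implicit Types f : X -> R.

Lemma integral_kiterS n x (g : X -> \bar R) :
  measurable_fun setT g -> (forall y, 0 <= g y)%E ->
  (\int[kiter P n.+1 x]_y g y = \int[kiter P n x]_y \int[P y]_z g z)%E.
Proof.
move=> mg g0.
rewrite (@eq_measure_integral _ _ _ setT (kcomp (kiter P n) (kernel.kernel_snd
  P) x))//.
exact: integral_kcomp.
Qed.

Lemma kiter_setT n x : kiter P n x setT = 1%E.
Proof.
elim: n => [|n ih] /=; first by rewrite /kdirac/= diracT.
have := @integral_kiterS n x (fun=> 1%E) (measurable_cst _) (fun=> lee01).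
rewrite integral_cst// mul1e => ->.
under eq_integral do rewrite integral_cst// mul1e prob_kernel.
by rewrite integral_cst// mul1e.
Qed.

Lemma kop_bounded f (M : R) x : measurable_fun setT f ->
  (forall y, `|f y| <= M) -> `|kop P f x| <= M.
Proof. by move=> mf fM; apply: normr_Rintegral_bounded1 => //;
  exact: prob_kernel. Qed.

Lemma iter_kop_bounded f (M : R) n : measurable_fun setT f ->
  (forall y, `|f y| <= M) ->
  measurable_fun setT (iter n (kop P) f) /\
  forall x, `|iter n (kop P) f x| <= M.
Proof.
move=> mf fM; elim: n => [//|n [m b]] /=; split; first exact: measurable_kop.
by move=> x; exact: kop_bounded.
Qed.

Lemma kopB_bounded f (M c : R) x : measurable_fun setT f ->
  (forall y, `|f y| <= M) -> kop P (fun y => f y - c) x = kop P f x - c.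
Proof.
move=> mf fM; rewrite kopB ?kop_cst//.
  by apply: integrable_bounded1 fM => //; exact: prob_kernel.
by apply: integrable_cst1; exact: prob_kernel.
Qed.

(** The composition rule for kernels is available for nonnegative integrands, so [f] is shifted by
    its bound [M]; as all measures involved have mass one, the shift cancels. *)
Lemma Rintegral_kiter f (M : R) n x : measurable_fun setT f ->
  (forall y, `|f y| <= M) ->
  \int[kiter P n x]_y f y = iter n (kop P) f x.
Proof.
elim: n f => [|n ih] f mf fM.
  rewrite /= /Rintegral integral_dirac// ?diracT ?mul1e//.
  exact/measurable_EFinP.
rewrite iterSr -ih; last 2 first.
- exact: measurable_kop.
- by move=> y; exact: kop_bounded.
have fM0 y : 0 <= f y + M by have := fM y; rewrite ler_norml; lra.
have mk := measurable_kop P mf.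
have kM y : `|kop P f y| <= M by exact: kop_bounded.
have shift (m : {measure set X -> \bar R}) (g : X -> R) : m setT = 1%E ->
  measurable_fun setT g -> (forall y, `|g y| <= M) ->
    (\int[m]_y (g y + M)%:E = (\int[m]_y g y + M)%:E :> \bar R)%E.
  move=> m1 mg gM; under eq_integral do rewrite EFinD.
  rewrite integralD_EFin//; [|exact: (integrable_bounded1 m1 mg gM)
    |exact: (integrable_cst1 m1 M)].
  have ig := integrable_bounded1 m1 mg gM.
  rewrite integral_cst// m1 mule1 EFinD; congr (_ + _)%E.
  by rewrite /Rintegral fineK//; exact: integrable_fin_num.
have mfM : measurable_fun setT (fun y => (f y + M)%:E).
  by apply/measurable_EFinP; exact: measurable_funD.
have := @integral_kiterS n x _ mfM (fun y => fM0 y).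
rewrite shift//; last exact: kiter_setT.
under eq_integral do rewrite (shift (P _) f (prob_kernel _) mf fM).
rewrite (shift (kiter P n x) _ (kiter_setT n x) mk kM).
by move=> h; apply: (@addIr _ M); exact: EFin_inj h.
Qed.

End kernel_iterates.

(** * Geometric convergence from the atom and from almost every point *)

Section total_variation.
Context {d} {X : measurableType d} {R : realType}.
Variables (P : R.-pker X ~> X) (pi : probability X R).
Hypothesis rev : reversible pi P.
Variables (A : set X) (q : R).
Hypotheses (q0 : 0 < q).
Hypothesis accA : accessible_atom pi P A.
Hypothesis contraction : forall f, sqint pi f -> \int[pi]_x f x = 0 ->
  inner pi (kop P f) (kop P f) <= q ^+ 2 * inner pi f f.
Implicit Types f : X -> R.

Lemma iter_kop_centered f n : centered pi f ->
  centered pi (iter n (kop P) f) /\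
  inner pi (iter n (kop P) f) (iter n (kop P) f) <= q ^+ (2 * n) * inner pi f f.
Proof.
move=> cf; elim: n => [|n [[s z] ih]] /=; first by rewrite mul1r.
split; first exact: centered_kop.
apply: le_trans (contraction s z) _.
by rewrite mulnS exprD -mulrA ler_wpM2l// exprn_ge0// ltW.
Qed.

Let pA := fine (pi A).
Let pA0 : 0 < pA. Proof. exact: atom_mass_gt0 accA. Qed.
Let mA : measurable A. Proof. by case: accA => -[]. Qed.

Section test_function.
Variable f : X -> R.
Hypotheses (mf : measurable_fun setT f) (f1 : forall x, `|f x| <= 1).

Let m := \int[pi]_x f x.
Let f0 x := f x - m.

Let sf : sqint pi f. Proof. exact: sqint_bounded f1. Qed.

Let m1 : `|m| <= 1.
Proof. by apply: normr_Rintegral_bounded1 => //; exact: probability_setT. Qed.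

Let iter_f0 n x : iter n (kop P) f0 x = iter n (kop P) f x - m.
Proof.
elim: n x => [//|n ih] x /=.
have [mi bi] := iter_kop_bounded P n mf f1.
rewrite -(kopB_bounded _ _ _ mi bi); congr kop.
by apply/funext => y; exact: ih.
Qed.

Lemma kiter_sub_mean n x :
  \int[kiter P n x]_y f y - \int[pi]_y f y = iter n (kop P) f0 x.
Proof. by rewrite (Rintegral_kiter P n x mf f1) iter_f0. Qed.

Let cf0 : centered pi f0.
Proof.
split; first by apply: sqintB => //; exact: sqint_cst.
rewrite RintegralB//; last 2 first.
- exact: sqint_integrable.
- exact/sqint_integrable/sqint_cst.
by rewrite Rintegral_probability_cst subrr.
Qed.

(** The variance of [f] is at most its second moment. *)
Let f0_le1 : inner pi f0 f0 <= 1.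
Proof.
have sm := sqint_cst pi m; have [sf0 z0] := cf0.
rewrite {1}/f0 innerBl// inner_cst// z0 mulr0 subr0 innerC innerBl//
  inner_cst//.
apply: (@le_trans _ _ (inner pi f f)).
  by rewrite gerBl -/m -expr2 sqr_ge0.
rewrite -[leRHS](Rintegral_probability_cst pi); apply: le_Rintegral => //.
- exact: sqintM.
- exact/sqint_integrable/sqint_cst.
- move=> x _; have := f1 x; rewrite -expr2 -real_normK ?num_real// => h.
  by rewrite -[leRHS](expr1n _ 2) lerXn2r ?nnegrE.
Qed.

(** For [n > 0] the iterate [w] is constant on [A], so its value there is its inner product with
    [\1_A / pA]. Since [w] is centered, 1 may be subtracted from this vector, which lowers its
    squared norm from [pA^-1] to [pA^-1 - 1]. At [n = 0] the function [f0] need not be constant on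
    [A]. *)
Lemma atom_iter_le n x : A x -> (0 < n)%N ->
  `|iter n (kop P) f0 x| <= Num.sqrt (pA^-1 - 1) * q ^+ n.
Proof.
case: n => // n Ax _.
have [[sw zw] lew] := iter_kop_centered n.+1 cf0.
set w := iter n.+1 (kop P) f0 in sw zw lew *.
have sA := sqint_indic accA.
have sA' := sqintZ pA^-1 sA.
have s1 := sqint_cst pi 1.
pose h y := pA^-1 * \1_A y - 1 : R.
have sh : sqint pi h by exact: sqintB.
have hE v : sqint pi v -> inner pi h v = pA^-1 * inner pi \1_A v - \int[pi]_y v
  y.
  by move=> sv; rewrite innerBl// innerZl// inner_cst// mul1r.
have Aw : inner pi \1_A w = pA * w x.
  rewrite /inner (@eq_Rintegral _ _ _ pi _ (fun y => w x * \1_A y)); last first.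
    move=> y _; rewrite indicE; have [yA|_] := boolP (y \in A).
      by rewrite mul1r mulr1; exact: (kop_atom accA _ (set_mem yA) Ax).
    by rewrite mul0r mulr0.
  rewrite RintegralZl//; last exact: sqint_integrable.
  by rewrite (Rintegral_indic1 accA) mulrC.
have hw : inner pi h w = w x.
  by rewrite hE// zw subr0 Aw mulrA mulVf ?mul1r// gt_eqF.
have AA : inner pi \1_A \1_A = pA.
  rewrite /pA -(Rintegral_indic1 accA); apply: eq_Rintegral => y _.
  by rewrite indicE; case: (y \in A); rewrite ?mulr1 ?mulr0.
have hh : inner pi h h = pA^-1 - 1.
  rewrite hE// (innerC _ \1_A) hE// AA (Rintegral_indic1 accA) -/pA.
  rewrite RintegralB//; last 2 first.
  - exact: sqint_integrable.
  - exact: sqint_integrable.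
  rewrite RintegralZl//; last exact: sqint_integrable.
  rewrite (Rintegral_indic1 accA) Rintegral_probability_cst -/pA.
  by field; rewrite gt_eqF.
have := cauchy_schwarz sh sw; rewrite hw hh => cs.
have h0 : 0 <= pA^-1 - 1 by rewrite -hh inner_ge0.
have R0 : 0 <= Num.sqrt (pA^-1 - 1) * q ^+ n.+1.
  by rewrite mulr_ge0 ?sqrtr_ge0// exprn_ge0// ltW.
rewrite -(ler_pXn2r (ltn0Sn 1)) ?nnegrE//.
rewrite real_normK ?num_real// exprMn sqr_sqrtr// -exprM mulnC.
apply: le_trans cs _; rewrite ler_wpM2l//.
apply: le_trans lew _; rewrite ler_piMr// exprn_ge0// ltW//.
Qed.

Variable W : X -> \bar R.
Hypotheses (mW : measurable_fun setT W) (W1 : forall x, (1 <= W x)%E).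
Hypothesis drift : forall x, ~ A x -> (\int[P x]_y W y <= q%:E * W x)%E.

(** The summand 2 bounds [f0] at time 0; the root is the constant of the estimate on the atom. *)
Let C := 2 + Num.sqrt (pA^-1 - 1).

Lemma iter_le_drift n x :
  (`|iter n (kop P) f0 x|%:E <= (C * q ^+ n)%:E * W x)%E.
Proof.
have C0 : 0 <= C by rewrite addr_ge0 ?sqrtr_ge0.
have Cq k : 0 <= C * q ^+ k by rewrite mulr_ge0// exprn_ge0// ltW.
have leW k a y : a <= C * q ^+ k -> (a%:E <= (C * q ^+ k)%:E * W y)%E.
  move=> aC; apply: le_trans (_ : (C * q ^+ k)%:E <= _)%E;
    first by rewrite lee_fin.
  by rewrite -[X in (X <= _)%E]mule1 lee_wpmul2l// lee_fin.
elim: n x => [|n ih] x.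
  apply: leW; rewrite expr0 mulr1 /= /C.
  apply: le_trans (ler_normB _ _) _; have := sqrtr_ge0 (pA^-1 - 1).
  have := f1 x; have := m1; lra.
have [Ax|nAx] := pselect (A x).
  apply: leW; apply: le_trans (atom_iter_le Ax _) _ => //.
  by apply: ler_wpM2r; [rewrite exprn_ge0// ltW|rewrite /C lerDr].
have mf0 : measurable_fun setT f0 by exact: measurable_funB.
have f02 y : `|f0 y| <= 2.
  by apply: le_trans (ler_normB _ _) _; have := f1 y; have := m1; lra.
have [mi bi] := iter_kop_bounded P n mf0 f02.
have ii : (P x).-integrable setT (EFin \o iter n (kop P) f0).
  by apply: integrable_bounded1 bi => //; exact: prob_kernel.
rewrite iterS /kop EFin_normr_Rintegral//.
apply: le_trans (le_abse_integral _ _ _) _ => //; first exact/measurable_EFinP.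
apply: (@le_trans _ _ (\int[P x]_y ((C * q ^+ n)%:E * W y))%E).
  by apply: ge0_le_lower_integral => y; [exact: abse_ge0|exact: ih].
rewrite ge0_integralZl//; last 2 first.
- by move=> y _; exact: le_trans (W1 y).
- by rewrite lee_fin.
apply: le_trans (lee_wpmul2l _ (drift nAx)) _; first by rewrite lee_fin.
by rewrite muleA -EFinM -mulrA -exprSr.
Qed.

End test_function.

Lemma var_dist_atom_le n : (0 < n)%N ->
  (ereal_sup [set var_dist (kiter P n x) pi | x in A] <=
   (Num.sqrt (pA^-1 - 1) * q ^+ n)%:E)%E.
Proof.
move=> n0; apply: ge_ereal_sup => _ [x Ax <-].
apply: ge_ereal_sup => _ [f [mf f1] <-].
by rewrite kiter_sub_mean// lee_fin; exact: atom_iter_le.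
Qed.

Lemma var_dist_ae_le (W : X -> \bar R) :
  measurable_fun setT W -> (forall x, (1 <= W x)%E) ->
  {ae pi, forall x, (W x < +oo)%E} ->
  (forall x, ~ A x -> (\int[P x]_y W y <= q%:E * W x)%E) ->
  {ae pi, forall x, exists C : R, forall n,
    (var_dist (kiter P n x) pi <= (C * q ^+ n)%:E)%E}.
Proof.
move=> mW W1 Wfin drift; apply: filterS Wfin => x Wx.
(* The constant depends on [x] through [W x] only, hence is uniform in the test function and in
   [n]. *)
exists ((2 + Num.sqrt (pA^-1 - 1)) * fine (W x)) => n.
apply: ge_ereal_sup => _ [f [mf f1] <-]; rewrite kiter_sub_mean//.
have WE : W x = (fine (W x))%:E.
  by rewrite fineK// ge0_fin_numE//; exact: le_trans (W1 x).
have := iter_le_drift mf f1 mW W1 drift n x.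
by rewrite WE -EFinM mulrAC.
Qed.

End total_variation.

(** * The drift function of the return time *)

Section drift_function.
Context {d} {X : measurableType d} {R : realType}.
Variables (P : R.-pker X ~> X) (A : set X) (kappa : R).
Hypotheses (mA : measurable A) (k1 : 1 < kappa).

Let k0 : 0 < kappa. Proof. exact: lt_trans k1. Qed.

(* [hit_moment n x] is [E_x (kappa ^ min (sigma, n))], where [sigma] is the
   first time [k >= 0] at which the chain is in [A]. *)
Fixpoint hit_moment (n : nat) (x : X) : \bar R :=
  if n is m.+1 then
    ((\1_A x)%:E + (\1_(~` A) x)%:E * (kappa%:E * \int[P x]_y hit_moment m y))%E
  else 1%E.

Lemma hit_moment_props n : measurable_fun setT (hit_moment n) /\
  forall x, (0 <= hit_moment n x)%E.
Proof.
elim: n => [|n [mh h0]] /=; first by split => // x; exact: lee01.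
have mP := measurable_int_kernel P mh h0.
split=> [|x].
  apply: emeasurable_funD; first exact/measurable_EFinP/measurable_indic.
  apply: emeasurable_funM; last exact: measurable_funeM.
  by apply/measurable_EFinP/measurable_indic; exact: measurableC.
apply: adde_ge0; first by rewrite lee_fin.
apply: mule_ge0; first by rewrite lee_fin.
by apply: mule_ge0; [rewrite lee_fin ltW|exact: integral_ge0].
Qed.

Let mh n : measurable_fun setT (hit_moment n). Proof. by case: (hit_moment_props
  n). Qed.
Let h0 n x : (0 <= hit_moment n x)%E. Proof. by case: (hit_moment_props n). Qed.

Lemma hit_moment_in n x : A x -> hit_moment n x = 1%E.
Proof.
by case: n => // n Ax /=; rewrite !indicE mem_set// memNset ?mul0e ?adde0//.
Qed.

Lemma hit_moment_out n x : ~ A x ->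
  hit_moment n.+1 x = (kappa%:E * \int[P x]_y hit_moment n y)%E.
Proof.
by move=> nAx /=; rewrite !indicE memNset// mem_set// add0e mul1e.
Qed.

Lemma hit_moment_nd x : nondecreasing_seq (hit_moment ^~ x).
Proof.
apply/nondecreasing_seqP => n; elim: n x => [|n ih] x.
  have [Ax|nAx] := pselect (A x); first by rewrite !hit_moment_in.
  rewrite hit_moment_out//= integral_cst// prob_kernel !mule1 lee_fin.
  exact: ltW.
have [Ax|nAx] := pselect (A x); first by rewrite !hit_moment_in.
rewrite !hit_moment_out//; apply: lee_wpmul2l; first by rewrite lee_fin ltW.
exact: ge0_le_lower_integral.
Qed.

Lemma hit_moment_ge1 n x : (1 <= hit_moment n x)%E.
Proof. exact: (hit_moment_nd x (leq0n n)). Qed.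

Definition hit_moment_lim x := limn (hit_moment ^~ x).

Let is_cvg x : cvgn (hit_moment ^~ x).
Proof. exact/ereal_nondecreasing_is_cvgn/hit_moment_nd. Qed.

Lemma hit_moment_le_lim n x : (hit_moment n x <= hit_moment_lim x)%E.
Proof.
apply: lime_ge => //; exists n => // m /= nm; exact: hit_moment_nd.
Qed.

Lemma hit_moment_lim_ge1 x : (1 <= hit_moment_lim x)%E.
Proof. exact: le_trans (hit_moment_ge1 0 x) (hit_moment_le_lim 0 x). Qed.

Lemma measurable_hit_moment_lim : measurable_fun setT hit_moment_lim.
Proof. by apply: (emeasurable_fun_cvg hit_moment) => // x _; exact: is_cvg. Qed.

(** Monotone convergence. It is used with [c = W x] off [A] and with the moment bound [L] on [A]. *)
Lemma int_hit_moment_lim_le x (c : \bar R) :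
  (forall n, kappa%:E * \int[P x]_y hit_moment n y <= c)%E ->
  (\int[P x]_y hit_moment_lim y <= kappa^-1%:E * c)%E.
Proof.
move=> hc; rewrite /hit_moment_lim monotone_convergence//; last first.
  by move=> y _; exact: hit_moment_nd.
apply: lime_le.
  apply: ereal_nondecreasing_is_cvgn => m n mn.
  by apply: ge0_le_lower_integral => // y; exact: hit_moment_nd.
have kN0 : kappa != 0 by rewrite gt_eqF.
apply: nearW => n; rewrite -[leLHS]mul1e -(mulVf kN0) EFinM -muleA.
by rewrite lee_wpmul2l// lee_fin invr_ge0 ltW.
Qed.

Lemma hit_moment_lim_drift x : ~ A x ->
  (\int[P x]_y hit_moment_lim y <= kappa^-1%:E * hit_moment_lim x)%E.
Proof.
move=> nAx; apply: int_hit_moment_lim_le => n.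
by rewrite -hit_moment_out//; exact: hit_moment_le_lim.
Qed.

Variables (pi : probability X R) (L : R).
Hypothesis irr : irreducible pi P.
Hypothesis boundA : forall n x, A x ->
  (kappa%:E * \int[P x]_y hit_moment n y <= L%:E)%E.
Hypothesis A0 : exists a, A a.

(** Since [P W <= b W] everywhere, [P^n W] is at most [b^n] at a point [a] of the atom, where
    [W a = 1]. Hence no [P^n (a, .)] charges [{W = +oo}], and irreducibility forces this set to be
    [pi]-null. *)
Lemma hit_moment_lim_fin : {ae pi, forall x, (hit_moment_lim x < +oo)%E}.
Proof.
set W := hit_moment_lim.
have W0 x : (0 <= W x)%E by apply: le_trans (hit_moment_lim_ge1 x).
have mW := measurable_hit_moment_lim.
(* One constant for both cases: [L] serves on [A], where [W >= 1] allows multiplying by [W], and 1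
   serves off [A]. *)
pose b := kappa^-1 * Num.max L 1.
have b0 : 0 <= b.
  apply: mulr_ge0; first by rewrite invr_ge0 ltW.
  by rewrite le_max ler01 orbT.
have Wb x : (\int[P x]_y W y <= b%:E * W x)%E.
  have k0' : (0 <= kappa^-1%:E :> \bar R)%E by rewrite lee_fin invr_ge0 ltW.
  rewrite EFinM -muleA; have [Ax|nAx] := pselect (A x).
    apply: le_trans (int_hit_moment_lim_le (fun n => boundA n Ax)) _.
    rewrite lee_wpmul2l//; apply: le_trans (_ : (Num.max L 1)%:E <= _)%E.
      by rewrite lee_fin le_max lexx.
    rewrite -[X in (X <= _)%E]mule1 lee_wpmul2l ?hit_moment_lim_ge1//.
    by rewrite lee_fin le_max ler01 orbT.
  apply: le_trans (hit_moment_lim_drift nAx) _; rewrite lee_wpmul2l//.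
  by rewrite -[X in (X <= _)%E]mul1e lee_wpmul2r// lee_fin le_max lexx orbT.
have Wn n x : (\int[kiter P n x]_y W y <= (b ^+ n)%:E * W x)%E.
  elim: n => [|n ih].
    by rewrite /= integral_dirac// diracT.
  rewrite integral_kiterS//.
  apply: (@le_trans _ _ (\int[kiter P n x]_y (b%:E * W y))%E).
    by apply: ge0_le_lower_integral => // y; exact: integral_ge0.
  have -> : (\int[kiter P n x]_y (b%:E * W y) = b%:E * \int[kiter P n x]_y W
    y)%E.
    by apply: ge0_integralZl => //; rewrite lee_fin.
  by rewrite exprS (EFinM b) -(muleA b%:E); apply: lee_wpmul2l;
    rewrite ?lee_fin.
have [a Aa] := A0; pose N := [set x | W x = +oo%E].
have mN : measurable N.
  by rewrite -[N]setTI; exact: (mW measurableT _ (emeasurable_set1 _)).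
have Na n : kiter P n a N = 0%E.
  have : (kiter P n a).-integrable setT W.
    apply/integrableP; split => //; under eq_integral do rewrite gee0_abs//.
    apply: le_lt_trans (Wn n a) _.
    rewrite (_ : W a = 1%E) ?mule1 ?ltry//.
    rewrite /W /hit_moment_lim; under eq_fun do rewrite hit_moment_in//.
    exact: lim_cst.
  move=> /(integrable_ae measurableT) aeW; apply: measure_negligible => //.
  by apply: negligibleS aeW => x /= Wx /(_ Logic.I); rewrite Wx.
exists N; split => //; last by move=> x /=; rewrite ltey => /negP/negPn/eqP.
apply/eqP; rewrite eq_le measure_ge0 andbT leNgt; apply/negP => piN.
by have [n _] := irr mN piN a; rewrite Na ltxx.
Qed.

End drift_function.

Lemma integral_cst_indic d (T : measurableType d) (R : realType)
    (mu : {measure set T -> \bar R}) (c : R) (E : set T) :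
  0 <= c -> measurable E ->
  (\int[mu]_(w in E) c%:E = \int[mu]_w (c * \1_E w)%:E)%E.
Proof.
move=> c0 mE; have mI : measurable_fun setT (fun w => (\1_E w)%:E : \bar R).
  exact/measurable_EFinP/measurable_indic.
have I0 w : setT w -> (0 <= (\1_E w)%:E :> \bar R)%E by rewrite lee_fin.
have := ge0_integralZl_EFin mu measurableT I0 mI c0.
rewrite integral_indic// setIT integral_cst// => <-.
Qed.

(** * From return times of the chain to moments computed with the kernel *)

Section return_time_moment.
Context {d} {X : measurableType d} {R : realType}.
Context {d'} {Omega : measurableType d'}.
Variables (P : R.-pker X ~> X) (Phi : nat -> {mfun Omega >-> X}).
Variables (Pr : X -> probability Omega R) (A : set X) (kappa : R).
Hypotheses (chain : markov_chain P Phi Pr) (mA : measurable A) (k1 : 1 < kappa).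

Let k0 : 0 < kappa. Proof. exact: lt_trans k1. Qed.

(** The event that the return time exceeds [k]; the position at time 0 is unconstrained, as the
    chain may start in [A]. *)
Definition avoids (k : nat) : set Omega :=
  [set w | forall j, (0 < j <= k)%N -> ~ A (Phi j w)].

Lemma avoids0 : avoids 0 = setT.
Proof. by apply/seteqP; split => // w _ [|j]. Qed.

Lemma avoidsS k : avoids k.+1 = avoids k `&` Phi k.+1 @^-1` (~` A).
Proof.
apply/seteqP; split => [w h|w [h hk] j].
  split=> [j /andP[j0 jk]|]; last by apply: h; rewrite ltnS leqnn.
  by apply: h; rewrite j0 ltnW.
by move=> /andP[j0]; rewrite leq_eqVlt => /predU1P[->//|jk]; apply: h;
  rewrite j0.
Qed.

Lemma avoids_filtration k : natural_filtration Phi k (avoids k).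
Proof.
elim: k => [|k ih].
  rewrite avoids0; rewrite -[setT]setD0.
  have [h0 hC _] := smallest_sigma_algebra setT (\bigcup_(k in [set k | (k <=
    0)%N])
    preimage_set_system setT (Phi k) measurable).
  exact: hC.
rewrite avoidsS.
set G := \bigcup_(j in [set j | (j <= k.+1)%N])
    preimage_set_system setT (Phi j) measurable.
have := @measurableI _ (g_sigma_algebraType G) (avoids k) (Phi k.+1 @^-1` (~`
  A)); apply.
  apply: sub_sigma_algebra2 ih => B [j /= jk hj]; exists j => //=.
  exact: leqW.
apply: sub_sigma_algebra; exists k.+1 => //=.
by exists (~` A); [exact: measurableC|rewrite setTI].
Qed.

Lemma measurable_avoids k : measurable (avoids k).
Proof.
elim: k => [|k ih]; first by rewrite avoids0.
rewrite avoidsS; apply: measurableI => //; rewrite -[X in measurable X]setTI.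
exact: (measurable_funP (Phi k.+1)) measurableT _ (measurableC mA).
Qed.

(** A return time exceeding [k] is an integer at least [k + 1] or infinite, which explains the
    exponent. *)
Lemma avoids_return_time k w : avoids k w ->
  ((kappa ^+ k.+1)%:E <= powRe kappa (return_time Phi A w))%E.
Proof.
move=> hw; have : (k.+1%:R%:E <= return_time Phi A w :> \bar R)%E.
  apply: le_ereal_inf_tmp => _ [n [n0 An] <-]; rewrite lee_fin ler_nat ltnNge.
  by apply/negP => nk; apply: (hw n) => //; rewrite n0.
case: return_time => [r| |]//=; last by move=> _; exact: leey.
by rewrite !lee_fin => kr; rewrite -powR_mulrn ?(ltW k0)// ler_powR// ltW.
Qed.

Let m_comp n (g : X -> \bar R) : measurable_fun setT g ->
  measurable_fun setT (fun w => g (Phi n w)).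
Proof. by move=> mg; exact: measurableT_comp. Qed.

Lemma markov_integral x n (E : set Omega) (g : X -> \bar R) :
  measurable E -> natural_filtration Phi n E ->
  measurable_fun setT g -> (forall y, 0 <= g y)%E ->
  (\int[Pr x]_(w in E) g (Phi n.+1 w) =
   \int[Pr x]_(w in E) \int[P (Phi n w)]_y g y)%E.
Proof.
move=> mE FE; have [_ mk] := chain.
have mS (D : set Omega) (h : Omega -> \bar R) : measurable_fun setT h ->
  measurable_fun D h by exact: measurable_funTS.
apply: (@ge0_measurable_ind _ _ _ (fun g => (\int[Pr x]_(w in E) g (Phi n.+1 w)
  =
   \int[Pr x]_(w in E) \int[P (Phi n w)]_y g y)%E)).
- move=> B mB.
  under [RHS]eq_integral do rewrite integral_indic// setIT.
  rewrite -mk// setIC -integral_indic//.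
  rewrite -[X in measurable X]setTI.
  exact: (measurable_funP (Phi n.+1)) measurableT _ mB.
- move=> f h mf mh f0 h0 hf hh.
  rewrite ge0_integralD//; [|by apply: mS; exact: m_comp|by apply: mS;
    exact: m_comp].
  rewrite hf hh -ge0_integralD//.
  + by apply: eq_integral => w _; rewrite ge0_integralD.
  + by move=> w _; exact: integral_ge0.
  + by apply/mS/(@m_comp _ (fun y => \int[P y]_z f z)%E)/measurable_int_kernel.
  + by move=> w _; exact: integral_ge0.
  + by apply/mS/(@m_comp _ (fun y => \int[P y]_z h z)%E)/measurable_int_kernel.
- move=> k f kk0 mf f0 hf.
  rewrite ge0_integralZl_EFin//; last by apply: mS; exact: m_comp.
  rewrite hf -ge0_integralZl_EFin//.
  + by apply: eq_integral => w _; rewrite ge0_integralZl_EFin.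
  + by move=> w _; exact: integral_ge0.
  + by apply/mS/(@m_comp _ (fun y => \int[P y]_z f z)%E)/measurable_int_kernel.
- move=> f_ mf f0 nd h.
  rewrite monotone_convergence//; last first.
    by move=> m; apply: mS; exact: m_comp.
  under eq_fun do rewrite h.
  rewrite -monotone_convergence//.
  + apply: eq_integral => w _; rewrite monotone_convergence// => y _; exact: nd.
  + move=> m.
    by apply/mS/(@m_comp _ (fun y => \int[P y]_z f_ m
      z)%E)/measurable_int_kernel.
  + by move=> m w _; exact: integral_ge0.
  + move=> w _ m1 m2 m12; apply: ge0_le_lower_integral => // y; exact: nd.
Qed.

Lemma initial_integral x (g : X -> \bar R) :
  measurable_fun setT g -> (forall y, 0 <= g y)%E ->
  (\int[Pr x]_w g (Phi 0%N w) = g x)%E.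
Proof.
move=> mg g0; have [ini _] := chain.
have := @ge0_integral_pushforward _ _ _ _ _ (Phi 0%N) (measurable_funP _) (Pr x)
  setT g measurableT mg (fun y _ => g0 y).
rewrite preimage_setT => <-.
rewrite (@eq_measure_integral _ _ _ setT (dirac x)); last first.
  by move=> B mB _; exact: ini.
by rewrite integral_dirac// diracT mul1e.
Qed.

(** The left side is the expectation of [kappa ^ min (tau, n + 1)], [tau] being the return time: the
    first transition costs the factor [kappa], and the hitting time counted from [Phi 1] is
    [tau - 1]. *)
Lemma hit_moment_le_return x n :
  (kappa%:E * \int[P x]_y hit_moment P A kappa n y <=
   \int[Pr x]_w powRe kappa (return_time Phi A w))%E.
Proof.
have hm m := (hit_moment_props P mA k1 m).1.
have h0 m := (hit_moment_props P mA k1 m).2.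
have mhP m j : measurable_fun setT (fun w => hit_moment P A kappa m (Phi j w)).
  exact: m_comp.
(* The witness [g] is [kappa ^ min (tau, n + k + 1)] on [avoids k] and 0 elsewhere, a measurable
   minorant of the moment. Generalizing over [k] lets each unfolding of [hit_moment] advance time by
   one. *)
suff key k : exists g : Omega -> \bar R,
    [/\ measurable_fun setT g, forall w, (0 <= g w)%E,
        forall w, avoids k w -> (g w <= powRe kappa (return_time Phi A w))%E,
        forall w, ~ avoids k w -> g w = 0%E &
        (\int[Pr x]_(w in avoids k) ((kappa ^+ k.+1)%:E *
          hit_moment P A kappa n (Phi k.+1 w)) = \int[Pr x]_w g w)%E].
  have [g [mg g0 gle _]] := key 0%N.
  rewrite avoids0 expr1 ge0_integralZl_EFin ?(ltW k0)// => gE.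
  have := @markov_integral x 0 setT _ measurableT _ (hm n) (h0 n).
  rewrite (@initial_integral x (fun y => \int[P y]_z hit_moment P A kappa n
    z)%E).
  - move=> <-; last by rewrite -avoids0; exact: avoids_filtration.
    rewrite gE; apply: ge0_le_lower_integral => // w.
    by apply: gle; rewrite avoids0.
  - exact: measurable_int_kernel.
  - by move=> y; exact: integral_ge0.
elim: n k => [|n ih] k.
  exists (fun w => (kappa ^+ k.+1 * \1_(avoids k) w)%:E); split.
  - by apply/measurable_EFinP/measurable_funM => //;
    exact/measurable_indic/measurable_avoids.
  - by move=> w; rewrite lee_fin mulr_ge0// exprn_ge0// ltW.
  - by move=> w hw; rewrite indicE mem_set// mulr1; exact: avoids_return_time.
  - by move=> w hw; rewrite indicE memNset// mulr0.
  - have mAv := measurable_avoids k.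
    under eq_integral do rewrite /= mule1.
    by rewrite integral_cst_indic// exprn_ge0// ltW.
have [g [mg g0 gle gout gE]] := ih k.+1.
pose B := avoids k `&` Phi k.+1 @^-1` A.
have mAv := measurable_avoids k.
have mB : measurable B.
  apply: measurableI => //; rewrite -[X in measurable X]setTI.
  exact: (measurable_funP (Phi k.+1)) measurableT _ mA.
have BE : avoids k = B `|` avoids k.+1.
  by rewrite avoidsS /B -setIUr -preimage_setU setUv preimage_setT setIT.
(* On [B] the return occurs exactly at time [k.+1]; on [avoids k.+1] the chain is still off [A], so
   [hit_moment] unfolds and the Markov property leads to the induction hypothesis. *)
exists (fun w => (kappa ^+ k.+1 * \1_B w)%:E + g w)%E; split.
- apply: emeasurable_funD => //.
  by apply/measurable_EFinP/measurable_funM => //; exact/measurable_indic.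
- by move=> w; rewrite adde_ge0// lee_fin mulr_ge0// exprn_ge0// ltW.
- move=> w hw; have [Aw|nAw] := pselect (A (Phi k.+1 w)).
    rewrite gout; last by rewrite avoidsS => -[_ /(_ Aw)].
    by rewrite indicE mem_set// mulr1 adde0; exact: avoids_return_time.
  rewrite indicE memNset ?mulr0 ?add0e; last by case=> _ /nAw.
  by apply: gle; rewrite avoidsS.
- move=> w hw; rewrite gout; last by rewrite avoidsS => -[/hw].
  by rewrite indicE memNset ?mulr0 ?adde0//; case => /hw.
rewrite BE ge0_integral_setU//; last 4 first.
- exact: measurable_avoids.
- by apply: measurable_funTS; apply: measurable_funeM; exact: mhP.
- by move=> w _; rewrite mule_ge0// lee_fin exprn_ge0// ltW.
- apply/disj_setPS => w [[_ Aw]]; rewrite avoidsS => -[_]; exact.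
rewrite ge0_integralD//; last 2 first.
- by move=> w _; rewrite lee_fin mulr_ge0// exprn_ge0// ltW.
- by apply/measurable_EFinP/measurable_funM => //; exact/measurable_indic.
congr (_ + _)%E.
  transitivity (\int[Pr x]_(w in B) (kappa ^+ k.+1)%:E)%E.
    apply: eq_integral => w /set_mem[_ Aw].
    by rewrite hit_moment_in// mule1.
  by rewrite integral_cst_indic// exprn_ge0// ltW.
rewrite -gE.
transitivity (\int[Pr x]_(w in avoids k.+1) ((kappa ^+ k.+2)%:E *
    \int[P (Phi k.+1 w)]_y hit_moment P A kappa n y))%E.
  apply: eq_integral => w /set_mem; rewrite avoidsS => -[_ nAw].
  by rewrite hit_moment_out// muleA -EFinM -exprSr.
have mAv1 := measurable_avoids k.+1.
rewrite !ge0_integralZl//.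
- by rewrite markov_integral//; exact: avoids_filtration.
- exact: measurable_funTS.
- by rewrite lee_fin exprn_ge0// ltW.
- apply: measurable_funTS.
  by apply: (@m_comp _ (fun y => \int[P y]_z hit_moment P A kappa n z)%E);
    exact: measurable_int_kernel.
- by move=> w _; exact: integral_ge0.
- by rewrite lee_fin exprn_ge0// ltW.
Qed.

End return_time_moment.

Theorem proposition3p1 (R : realType)
    (d : measure_display) (X : measurableType d)
    (d' : measure_display) (Omega : measurableType d')
    (P : R.-pker X ~> X) (pi : probability X R)
    (Phi : nat -> {mfun Omega >-> X}) (Pr : X -> probability Omega R)
    (A : set X) (kappa : R) :
  countably_generated X ->
  markov_chain P Phi Pr ->
  invariant_probability pi P ->
  irreducible pi P ->
  abs_continuous pi P ->
  reversible pi P ->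
  nonneg_definite pi P ->
  accessible_atom pi P A ->
  1 < kappa ->
  (ereal_sup [set \int[Pr x]_w powRe kappa (return_time Phi A w) | x in A]
     < +oo)%E ->
  [/\ (r0 pi P <= (kappa^-1)%:E)%E,
      (forall n, (0 < n)%N ->
        (ereal_sup [set var_dist (kiter P n x) pi | x in A]
           <= (Num.sqrt ((fine (pi A))^-1 - 1) * kappa ^- n)%:E)%E) &
      {ae pi, forall x, exists C : R, forall n,
        (var_dist (kiter P n x) pi <= (C * kappa ^- n)%:E)%E}].
Proof.
move=> _ chain _ irr _ rev psd accA k1 Lfin.
have mA : measurable A by case: accA => -[].
have k0 : 0 < kappa by exact: lt_trans k1.
have q0 : 0 < kappa^-1 by rewrite invr_gt0.
have q1 : kappa^-1 <= 1 by rewrite invf_le1// ltW.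
set S := ereal_sup _ in Lfin.
have momentA n x : A x -> (kappa%:E * \int[P x]_y hit_moment P A kappa n y <=
  S)%E.
  move=> Ax; apply: le_trans (hit_moment_le_return chain mA k1 x n) _.
  by apply: ereal_sup_ubound; exists x.
have [a Aa] := atom_nonempty accA.
have S0 : (0 <= S)%E.
  apply: le_trans (momentA 0%N a Aa); apply: mule_ge0;
    first by rewrite lee_fin ltW.
  exact: integral_ge0.
(* Nonemptiness of the atom gave [0 <= S], which excludes [-oo]; [fine S] is then the real bound [L]
   used for the finiteness of [W]. *)
have SE : S = (fine S)%:E by rewrite fineK// ge0_fin_numE.
rewrite SE in momentA.
pose W := hit_moment_lim P A kappa.
have mW : measurable_fun setT W := measurable_hit_moment_lim P mA k1.
have W1 : forall x, (1 <= W x)%E := hit_moment_lim_ge1 P mA k1.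
have Wfin : {ae pi, forall x, (W x < +oo)%E}.
  by apply: (hit_moment_lim_fin mA k1 irr momentA); exists a.
have drift : forall x, ~ A x -> (\int[P x]_y W y <= kappa^-1%:E * W x)%E.
  exact: (hit_moment_lim_drift P mA k1).
have off := inner_kop_le_off_atom rev q0 mW W1 Wfin drift.
have contraction f := kop_contraction rev psd q0 q1 accA off (f := f).
split.
- exact: r0_le.
- move=> n n0; rewrite -exprVn; exact: var_dist_atom_le.
- have := var_dist_ae_le rev q0 accA contraction mW W1 Wfin drift.
  by apply: filterS => x [C hC]; exists C => n; rewrite -exprVn.
Qed.
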